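(* Let $(\Sigma^n,g,h,u,\mu,\lambda)$ be a compact gradient Einstein-type structure isometrically immersed by $\phi:\Sigma^n\to I\times_f M^n$ into a warped product, with potential function $h=\pi_I\circ\phi$. If the mean curvature $H$ of $\Sigma^n$ satisfies $0\le H\le (\log f)'(h)$ on $\Sigma$, then $\Sigma^n$ is Einstein harmonic, i.e. $h$ is constant (so that $Ric_g-\alpha u^*g'=\lambda g$ and $\tau_g u=0$).
   Context: A gradient Einstein-type structure $(\Sigma^n,g,h,u,\mu,\lambda)$ consists of a connected, complete (possibly compact) Riemannian manifold $(\Sigma^n,g)$, a real number $\alpha>0$, a smooth map $u:(\Sigma^n,g)\to(N^p,g')$ into a Riemannian manifold, with tension field $\tau_g u=\mathrm{trace}\,\nabla(du)$, and smooth functions $h,\mu,\lambda$ on $\Sigma$ such that $Ric_g-\alpha u^*g'+\mathrm{Hess}\,h-\mu\,dh\otimes dh=\lambda g$ and $\tau_g u=du(\nabla h)$. It is called Einstein harmonic (trivial) if $h$ is constant. $I\times_f M^n$ is $I\times M^n$ with metric $\langle\,,\rangle=\pi_I^*(dt^2)+f^2(\pi_I)\pi_M^*(g_M)$, where $I\subset\mathbb{R}$ is an open interval, $f:I\to(0,\infty)$ is smooth, and $M^n$ is a connected oriented Riemannian manifold. For an isometric immersion $\phi$ of an oriented hypersurface $\Sigma^n$ with unit normal (Gauss map) $\nu$, the shape operator is $AX=-\overline\nabla_X\nu$ and the mean curvature $H$ is given by $nH=\mathrm{tr}\,A$. The height function is $h=\pi_I\circ\phi$. *)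

(* Defs.v *)
From HB Require Import structures.
From mathcomp Require Import all_boot all_order all_algebra.
From mathcomp Require Import all_classical all_reals all_analysis.
Set Implicit Arguments.
Unset Strict Implicit.
Unset Printing Implicit Defensive.
Import Order.TTheory GRing.Theory Num.Theory.
Import numFieldNormedType.Exports.
Local Open Scope classical_set_scope.
Local Open Scope ring_scope.

(* Finite-dimensional Riemannian geometry in the classical language of atlases
   and components. Vectors are rows: the Jacobian ['J F y] of the library has
   [('J F y) a k] equal to the a-th partial derivative of the k-th component of
   F, so a tangent vector v is mapped to [v *m 'J F y]. *)

(** * Smooth functions on open subsets of normed spaces *)

(* Only used for open U and finite-dimensional V. *)
Fixpoint Ck_on (R : realType) (V W : normedModType R) (k : nat) (U : set V)
    (F : V -> W) : Prop :=
  if k is k'.+1 then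
    (forall y, U y -> differentiable F y) /\
    (forall v, Ck_on k' U (fun y => 'D_v F y))
  else forall y, U y -> {for y, continuous F}.

Definition smooth_on (R : realType) (V W : normedModType R) (U : set V)
    (F : V -> W) : Prop := forall k, Ck_on k U F.

(** * Tensor calculus on an open subset of R^n carrying a metric G *)

Section LocalCalculus.
Variables (R : realType) (n : nat).
Implicit Types (G : 'rV[R]_n -> 'M[R]_n) (F : 'rV[R]_n -> R) (y : 'rV[R]_n).

Definition pd (a : 'I_n) F y : R :=
  'D_(delta_mx 0 a) (F : 'rV[R]_n -> R^o) y.

Definition dif F y : 'rV[R]_n := \row_a pd a F y.

Definition grad G F y : 'rV[R]_n := dif F y *m invmx (G y).

(* [christoffel G a b c] is the symbol with lower indices a, b, upper index c. *)
Definition christoffel G (a b c : 'I_n) y : R :=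
  2^-1 * \sum_d invmx (G y) c d *
    (pd a (fun z => G z b d) y + pd b (fun z => G z a d) y
     - pd d (fun z => G z a b) y).

(* The d-th component of Riem(e_a, e_b) e_c, with the convention
   Riem(X, Y) = [nabla_X, nabla_Y] - nabla_[X, Y]. *)
Definition curvature G (a b c d : 'I_n) y : R :=
  pd a (christoffel G b c d) y - pd b (christoffel G a c d) y
  + \sum_e (christoffel G b c e y * christoffel G a e d y
            - christoffel G a c e y * christoffel G b e d y).

(* Ric(Y, Z) is the trace of X |-> Riem(X, Y) Z. *)
Definition ricci G y : 'M[R]_n :=
  \matrix_(b, c) \sum_a curvature G a b c a y.

Definition hessian G F y : 'M[R]_n :=
  \matrix_(a, b) (pd a (pd b F) y - \sum_c christoffel G a b c y * pd c F y).

End LocalCalculus.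

(** * Maps from an open subset of R^n to one of R^m *)

Section LocalMaps.
Variables (R : realType) (n m : nat).
Implicit Types (G : 'rV[R]_n -> 'M[R]_n) (y : 'rV[R]_n).
Implicit Types (U V : 'rV[R]_n -> 'rV[R]_m).

Definition pullback (G' : 'rV[R]_m -> 'M[R]_m) U y : 'M[R]_n :=
  'J U y *m G' (U y) *m ('J U y)^T.

(* The k-th component of nabla(dU), as a bilinear form. *)
Definition nabla_d G (G' : 'rV[R]_m -> 'M[R]_m) U (k : 'I_m) y : 'M[R]_n :=
  \matrix_(a, b) (hessian G (fun z => U z 0 k) y a b
    + \sum_c \sum_d christoffel G' c d k (U y) * 'J U y a c * 'J U y b d).

Definition tension G (G' : 'rV[R]_m -> 'M[R]_m) U y : 'rV[R]_m :=
  \row_k \sum_a \sum_b invmx (G y) a b * nabla_d G G' U k y a b.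

(* Row a holds the derivative, for the Levi-Civita connection of G', of the
   vector field V along U in the direction of the a-th coordinate vector. *)
Definition nabla_along (G' : 'rV[R]_m -> 'M[R]_m) U V y : 'M[R]_(n, m) :=
  \matrix_(a, k) (pd a (fun z => V z 0 k) y
    + \sum_c \sum_d christoffel G' c d k (U y) * 'J U y a c * V y 0 d).

End LocalMaps.

(** * Riemannian manifolds *)

(* Raw data; [riemannian] below says when they form a Riemannian manifold.
   [chart i] only matters on [chart_dom i], and [metric i] on its image. *)
Record riemData (R : realType) (n : nat) := RiemData {
  carrier :> topologicalType;
  chart_ix : Type;
  chart_dom : chart_ix -> set carrier;
  chart : chart_ix -> carrier -> 'rV[R]_n;
  metric : chart_ix -> 'rV[R]_n -> 'M[R]_n }.
Arguments chart_dom {R n} X : rename.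
Arguments chart {R n} X : rename.
Arguments metric {R n} X : rename.

Section Manifolds.
Variables (R : realType) (n : nat) (X : riemData R n).

Definition chart_im (i : chart_ix X) (A : set X) : set 'rV[R]_n :=
  chart X i @` (chart_dom X i `&` A).

(* The expression of F in chart i, i.e., F composed with the inverse chart
   (and 0 outside the image of the chart). *)
Definition loc (W : normedModType R) (i : chart_ix X) (F : X -> W)
    (y : 'rV[R]_n) : W :=
  xget 0 [set F x | x in chart_dom X i `&` chart X i @^-1` [set y]].

Definition smooth_fun (F : X -> R) : Prop :=
  forall i, @smooth_on R 'rV[R]_n R^o (chart_im i setT) (loc i (F : X -> R^o)).

(* A continuous injective open map is a homeomorphism onto its open image. *)
Definition smooth_atlas : Prop :=
  [/\ forall x, exists i, chart_dom X i x,
      forall i, [/\ open (chart_dom X i),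
        {in chart_dom X i &, injective (chart X i)},
        forall x, chart_dom X i x -> {for x, continuous (chart X i)}
        & forall A : set X, open A -> open (chart_im i A)]
    & forall i j, smooth_on (chart_im i (chart_dom X j)) (loc i (chart X j))].

Definition smooth_manifold : Prop :=
  [/\ hausdorff_space X, @second_countable X & smooth_atlas].

Definition riemannian_metric : Prop :=
  [/\ forall i, smooth_on (chart_im i setT) (metric X i),
      forall i y, chart_im i setT y -> (metric X i y)^T = metric X i y,
      forall i y, chart_im i setT y -> forall v : 'rV[R]_n, v != 0 ->
        0 < (v *m metric X i y *m v^T) 0 0
    & forall i j y, chart_im i (chart_dom X j) y ->
        metric X i y = pullback (metric X j) (loc i (chart X j)) y].

Definition riemannian : Prop := smooth_manifold /\ riemannian_metric.

Definition oriented_atlas : Prop :=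
  forall i j y, chart_im i (chart_dom X j) y ->
    0 < \det ('J (loc i (chart X j)) y).

Definition geodesic (gamma : R -> X) : Prop :=
  continuous gamma /\
  forall i, let c : R^o -> 'rV[R]_n := chart X i \o gamma in
    @smooth_on R R^o 'rV[R]_n (gamma @^-1` chart_dom X i) c /\
    forall t, chart_dom X i (gamma t) -> forall k,
      derive1n 2 c t 0 k
      + \sum_a \sum_b christoffel (metric X i) a b k (c t)
                      * derive1 c t 0 a * derive1 c t 0 b = 0.

Definition complete : Prop :=
  forall i x (v : 'rV[R]_n), chart_dom X i x ->
    exists gamma, [/\ geodesic gamma, gamma 0 = x
      & derive1 (chart X i \o gamma : R^o -> 'rV[R]_n) 0 = v].

End Manifolds.

Lemma locE (R : realType) (n : nat) (X : riemData R n) (W : normedModType R)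
    (i : chart_ix X) (F : X -> W) (x : X) :
  smooth_atlas X -> chart_dom X i x -> loc i F (chart X i x) = F x.
Proof.
move=> [_ /(_ i) [_ inj _ _] _] ix; rewrite /loc; case: xgetP => [w _|].
  by case=> x' [ix' /= e] <-; congr F; apply: inj; rewrite ?inE.
by move=> /(_ (F x)) []; exists x.
Qed.

(** * Maps between Riemannian manifolds *)

Section Maps.
Variables (R : realType) (n m : nat) (X : riemData R n) (Y : riemData R m).
Implicit Type u : X -> Y.

(* The expression of u in chart i at the source and chart j at the target; it
   is meaningful on the set [loc_dom u i j]. *)
Definition locmap u (i : chart_ix X) (j : chart_ix Y)
  : 'rV[R]_n -> 'rV[R]_m := loc i (chart Y j \o u).

Definition loc_dom u (i : chart_ix X) (j : chart_ix Y) : set 'rV[R]_n :=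
  chart_im i (u @^-1` chart_dom Y j).

Definition smooth_map u : Prop :=
  continuous u /\ forall i j, smooth_on (loc_dom u i j) (locmap u i j).

Definition isometric_immersion u : Prop :=
  [/\ smooth_map u,
      forall i j y, loc_dom u i j y -> row_free ('J (locmap u i j) y)
    & forall i j y, loc_dom u i j y ->
        pullback (metric Y j) (locmap u i j) y = metric X i y].

(* A vector field along u is given by its components [V j x] in each chart j of
   Y around u x. *)
Definition smooth_field_along u (V : chart_ix Y -> X -> 'rV[R]_m) : Prop :=
  (forall x j k, chart_dom Y j (u x) -> chart_dom Y k (u x) ->
     V k x = V j x *m 'J (loc j (chart Y k)) (chart Y j (u x))) /\
  (forall i j, smooth_on (loc_dom u i j) (loc i (V j))).

End Maps.

(** * Gradient Einstein-type structures *)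

Section Einstein.
Variables (R : realType) (n p : nat) (X : riemData R n) (N : riemData R p).
Variables (alpha : R) (h : X -> R) (u : X -> N) (mu lambda : X -> R).

Definition einstein_type_equations : Prop :=
  forall i j x, chart_dom X i x -> chart_dom N j (u x) ->
    let y := chart X i x in
    let G := metric X i in let G' := metric N j in
    let F := loc i (h : X -> R^o) in let U := locmap u i j in
    ricci G y - alpha *: pullback G' U y + hessian G F y
      - mu x *: ((dif F y)^T *m dif F y) = lambda x *: G y
    /\ tension G G' U y = grad G F y *m 'J U y.

Definition gradient_einstein_type : Prop :=
  [/\ [/\ riemannian X, connected [set: X] & complete X],
      riemannian N,
      0 < alpha,
      [/\ smooth_map u, smooth_fun h, smooth_fun mu & smooth_fun lambda]
    & einstein_type_equations].

Definition einstein_harmonic : Prop := exists c, forall x, h x = c.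

(* The system to which the structure equations reduce when h is constant. *)
Definition harmonic_einstein_equations : Prop :=
  forall i j x, chart_dom X i x -> chart_dom N j (u x) ->
    let y := chart X i x in
    let G := metric X i in let G' := metric N j in
    let U := locmap u i j in
    ricci G y - alpha *: pullback G' U y = lambda x *: G y
    /\ tension G G' U y = 0.

End Einstein.

(** * Warped products I x_f M and their hypersurfaces *)

Section Warped.
Variables (R : realType) (n : nat) (I : set R) (f : R -> R) (M : riemData R n).

(* The carrier is I * M, with I seen as a subspace of R; the charts are
   (t, x) |-> (t, chart x), and the metric is dt^2 + f(t)^2 g_M. *)
Definition warped : riemData R (1 + n) :=
  @RiemData R (1 + n) (set_type I * M)%type (chart_ix M)
    (fun i q => chart_dom M i q.2)
    (fun i q => row_mx (\val q.1)%:M (chart M i q.2))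
    (fun i z => block_mx 1%:M 0 0 (f (lsubmx z 0 0) ^+ 2 *: metric M i (rsubmx z))).

Variables (S : riemData R n) (phi : S -> warped).

Definition height (x : S) : R := \val (phi x).1.

Variable nu : chart_ix warped -> S -> 'rV[R]_(1 + n).

Definition unit_normal : Prop :=
  smooth_field_along phi nu /\
  forall i j x, chart_dom S i x -> chart_dom warped j (phi x) ->
    let G := metric warped j (chart warped j (phi x)) in
    nu j x *m G *m (nu j x)^T = 1%:M /\
    'J (locmap phi i j) (chart S i x) *m G *m (nu j x)^T = 0.

(* A X = - nabla_X nu, both sides being read as vectors of the warped product
   through the differential of phi. *)
Definition shape_operator (A : chart_ix S -> S -> 'M[R]_n) : Prop :=
  forall i j x, chart_dom S i x -> chart_dom warped j (phi x) ->
    let y := chart S i x in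
    A i x *m 'J (locmap phi i j) y
    = - nabla_along (metric warped j) (locmap phi i j) (loc i (nu j)) y.

Definition mean_curvature (H : S -> R) : Prop :=
  exists2 A, shape_operator A &
    forall i x, chart_dom S i x -> n%:R * H x = \tr (A i x).

End Warped.

(* Main.v *)
Require Import Defs.
From HB Require Import structures.
From mathcomp Require Import all_boot all_order all_algebra.
From mathcomp Require Import all_classical all_reals all_analysis.
From mathcomp Require Import ring lra.
Set Implicit Arguments.
Unset Strict Implicit.
Unset Printing Implicit Defensive.
Import Order.TTheory GRing.Theory Num.Theory.
Import numFieldNormedType.Exports.
Local Open Scope classical_set_scope.
Local Open Scope ring_scope.

(** Write L = (log f)'(h) and Theta = <nu, d/dt>. The Gauss formula, together with
    the Christoffel symbols of dt^2 + f(t)^2 g_M, gives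
      Hess h = L (g - dh (x) dh) + Theta <A ., .>,
    whose trace is Delta h + L |dh|^2 = n (L + H Theta). Since |Theta| <= 1 and
    0 <= H <= L, the right-hand side is nonnegative. The left-hand side is a
    second-order elliptic operator without zeroth-order term applied to h, so by
    Hopf's strong maximum principle the set where h attains its maximum is open;
    it is closed and nonempty, and Sigma is compact and connected. *)

(** * Calculus of partial derivatives *)

(** The inequality is only weak: L + H Theta may vanish, so a maximum point by itself yields no
    contradiction, and this is why the strong maximum principle is called for. The quadratic term L
    |dh|^2 becomes linear by freezing one factor dh in the first-order coefficient. The coefficients
    then involve only the metric, f and first derivatives of h, and are continuous in a chart. A,
    Theta and H occur on the right-hand side alone, where a sign at each point suffices; it comes
    from H Theta >= -H >= -L. For the Christoffel symbols two facts about the warped metric G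
    matter: its row for t is constant, and its t-derivative is 2 (f'/f) (G - dt (x) dt). They give
    the symbols with upper index t, which are all that the t-component of the Gauss formula
    requires. The Gauss formula itself is derived from compatibility of the connection with the
    metric and absence of torsion. Openness of the maximum set is local, so one chart of Sigma and
    one of the product suffice, with tensors written as matrices. *)

Section Partial.
Variables (R : realType) (n : nat).
Implicit Types (F G : 'rV[R]_n -> R) (y v : 'rV[R]_n) (a b : 'I_n).

Lemma pd_ext a F G y : (\near y, F y = G y) -> pd a F y = pd a G y.
Proof. exact: near_eq_derive. Qed.

Lemma dirder F y v : differentiable (F : 'rV[R]_n -> R^o) y ->
  'D_v (F : 'rV[R]_n -> R^o) y = \sum_a v 0 a * pd a F y.
Proof.
move=> dF; rewrite deriveE // [in LHS](row_sum_delta v) linear_sum /=.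
by apply: eq_bigr => a _; rewrite linearZ /= /pd deriveE.
Qed.

Lemma pdD a F G y : differentiable (F : 'rV[R]_n -> R^o) y ->
  differentiable (G : 'rV[R]_n -> R^o) y ->
  pd a (fun z => F z + G z) y = pd a F y + pd a G y.
Proof. by move=> dF dG; apply: deriveD; exact: diff_derivable. Qed.

Lemma pdM a F G y : differentiable (F : 'rV[R]_n -> R^o) y ->
  differentiable (G : 'rV[R]_n -> R^o) y ->
  pd a (fun z => F z * G z) y = F y * pd a G y + G y * pd a F y.
Proof. by move=> dF dG; apply: deriveM; exact: diff_derivable. Qed.

Lemma differentiable_fsum m (F : 'I_m -> 'rV[R]_n -> R) y :
  (forall i, differentiable (F i : 'rV[R]_n -> R^o) y) ->
  differentiable ((fun z => \sum_i F i z) : 'rV[R]_n -> R^o) y.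
Proof.
move=> dF; have -> : (fun z => \sum_i F i z) = \sum_i (F i : 'rV[R]_n -> R^o).
  by apply/funext => z; rewrite fct_sumE.
exact: differentiable_sum.
Qed.

Lemma pd_sum m a (F : 'I_m -> 'rV[R]_n -> R) y :
  (forall i, differentiable (F i : 'rV[R]_n -> R^o) y) ->
  pd a (fun z => \sum_i F i z) y = \sum_i pd a (F i) y.
Proof.
move=> dF; have -> : (fun z => \sum_i F i z) = \sum_i (F i : 'rV[R]_n -> R^o).
  by apply/funext => z; rewrite fct_sumE.
by apply: derive_sum => i; exact: diff_derivable.
Qed.

Lemma differentiable_scalarM F G y : differentiable (F : 'rV[R]_n -> R^o) y ->
  differentiable (G : 'rV[R]_n -> R^o) y ->
  differentiable ((fun z => F z * G z) : 'rV[R]_n -> R^o) y.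
Proof. exact: differentiableM. Qed.

Lemma differentiable_const (c : R) y :
  differentiable ((fun=> c) : 'rV[R]_n -> R^o) y.
Proof. exact: (@differentiable_cst _ _ R^o c y). Qed.

Lemma pd_const a (c : R) y : pd a (fun=> c) y = 0.
Proof. exact: (@derive_cst _ _ R^o). Qed.

Lemma differentiable_scale (c : R) F y : differentiable (F : 'rV[R]_n -> R^o) y ->
  differentiable ((fun z => c * F z) : 'rV[R]_n -> R^o) y.
Proof.
by move=> dF; apply: differentiable_scalarM => //; exact: differentiable_const.
Qed.

Lemma pdZ a (c : R) F y : differentiable (F : 'rV[R]_n -> R^o) y ->
  pd a (fun z => c * F z) y = c * pd a F y.
Proof.
by move=> dF; rewrite pdM// pd_const mulr0 addr0.
Qed.

Lemma differentiable_add F G y : differentiable (F : 'rV[R]_n -> R^o) y ->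
  differentiable (G : 'rV[R]_n -> R^o) y ->
  differentiable ((fun z => F z + G z) : 'rV[R]_n -> R^o) y.
Proof. exact: differentiableD. Qed.

Lemma differentiable_coordinate i y :
  differentiable ((fun z : 'rV[R]_n => z 0 i) : 'rV[R]_n -> R^o) y.
Proof. exact: differentiable_coord. Qed.

Lemma pd_coordinate a i y : pd a (fun z => z 0 i) y = (a == i)%:R.
Proof.
have [d e] := @is_derive_id R 'rV[R]_n y (delta_mx 0 a).
by move: e; rewrite derive_mx// => /matrixP/(_ 0 i); rewrite !mxE eqxx eq_sym.
Qed.

End Partial.

Section Components.
Variables (R : realType).

Lemma near_eq_differentiable (V W : normedModType R) (F G : V -> W) p :
  (\near p, F p = G p) -> differentiable F p -> differentiable G p.
Proof.
move=> FG /diff_locallyP[cF EF].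
have EG : G \o shift p = cst (G p) + 'd F p +o_ (0 : V) id.
  apply/eqaddoP => e e0; move: EF => /eqaddoP /(_ e e0).
  have FG0 : \forall h \near (0 : V), F (h + p) = G (h + p).
    by have := FG; rewrite (near_shift 0) /= subr0; apply: filterS.
  move=> H; apply: filterS2 FG0 H => h /= E.
  by rewrite !fctE /= E (nbhs_singleton FG).
(* ['d G p] is a chosen linear map; uniqueness of the linear part identifies it with ['d F p]. *)
by apply/diff_locallyP; rewrite (diff_unique cF EG).
Qed.

Lemma differentiable_entry (V : normedModType R) p q (F : V -> 'M[R]_(p, q)) y i j :
  differentiable F y -> differentiable ((fun z => F z i j) : V -> R^o) y.
Proof.
by move=> dF; apply: (@differentiable_comp _ _ _ _ F (fun N => N i j : R^o)) => //;
  exact: differentiable_coord.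
Qed.

Lemma derive_entry (V : normedModType R) p q (F : V -> 'M[R]_(p, q)) y v i j :
  differentiable F y ->
  'D_v ((fun z => F z i j) : V -> R^o) y = ('D_v F y) i j.
Proof.
by move=> dF; rewrite derive_mx ?mxE//; exact: diff_derivable.
Qed.

Lemma jacobianE n m (F : 'rV[R]_n -> 'rV[R]_m) y a k :
  differentiable F y -> ('J F y) a k = pd a (fun z => F z 0 k) y.
Proof.
move=> dF; rewrite /pd derive_entry// deriveEjacobian//.
by rewrite -rowE [RHS]mxE.
Qed.

Lemma pd_comp n m (F : 'rV[R]_n -> 'rV[R]_m) (G : 'rV[R]_m -> R) y a :
  differentiable F y -> differentiable (G : 'rV[R]_m -> R^o) (F y) ->
  pd a (fun z => G (F z)) y = \sum_c 'J F y a c * pd c G (F y).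
Proof.
move=> dF dG; rewrite /pd deriveE; last exact: (@differentiable_comp _ _ _ _ F).
rewrite (@diff_comp _ _ _ _ F (G : _ -> R^o)) //=.
rewrite -(deriveE _ dF) (deriveEjacobian _ dF) -(deriveE _ dG) dirder //.
by apply: eq_bigr => c _; rewrite -rowE [in LHS]mxE.
Qed.

End Components.

(** * Restriction to lines: mean value theorem, conditions at a maximum, symmetry of second
    derivatives *)

Section Line.
Variables (R : realType) (V : normedModType R).
Implicit Types (F : V -> R^o) (y v w : V).

(** With [y + t *: v] as base point the two difference quotients are the same function, so
    one-variable calculus applies to [F] along a line. *)
Lemma is_derive_line F y v (t : R) : derivable F (y + t *: v) v ->
  is_derive t 1 ((fun s => F (y + s *: v)) : R -> R) ('D_v F (y + t *: v)).
Proof.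
have E : (fun h : R => h^-1 *: (((fun s => F (y + s *: v)) \o shift t) (h *: 1)
   - F (y + t *: v))) = (fun h : R => h^-1 *: ((F \o shift (y + t *: v)) (h *: v)
   - F (y + t *: v))).
  apply/funext => h /=; congr (_ *: (F _ - _)).
  by rewrite [h%:A]mulr1 scalerDl addrCA.
by move=> dF; split; rewrite /derivable /derive E.
Qed.

Lemma line_MVT F y v (s : R) : 0 < s ->
  (forall t, 0 <= t <= s -> derivable F (y + t *: v) v) ->
  exists2 c, 0 < c < s & F (y + s *: v) - F y = 'D_v F (y + c *: v) * s.
Proof.
move=> s0 dF.
have [|||c] := @MVT R (fun t => F (y + t *: v)) (fun t => 'D_v F (y + t *: v)) 0 s.
- by [].
- move=> t; rewrite in_itv /= => /andP[t0 ts].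
  by apply: is_derive_line; apply: dF; rewrite !ltW.
- apply: derivable_within_continuous => t; rewrite in_itv /= => ts.
  by have [] := is_derive_line (dF t ts).
by rewrite in_itv /= scale0r addr0 subr0 => cs ?; exists c.
Qed.

Lemma near_line y v (P : set V) : (\near y, P y) ->
  exists2 r : R, 0 < r & forall t, `|t| <= r -> P (y + t *: v).
Proof.
move=> Py; have : \forall t \near (0 : R), P (y + t *: v).
  have : (fun t : R => y + t *: v) @ 0 --> y.
    rewrite -[X in _ --> X](addr0 y) -(scale0r v); apply: cvgD; first exact: cvg_cst.
    exact: scalel_continuous.
  exact.
move=> /nbhs_ballP [e /= e0 eP]; exists (e / 2); first by rewrite divr_gt0.
move=> t te; apply: eP; rewrite -ball_normE /= sub0r normrN.
by rewrite (le_lt_trans te)// ltr_pdivrMr// mulr_natr mulr2n ltrDl.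
Qed.

Lemma local_max_derive F p v : (\forall y \near p, F y <= F p) ->
  (\forall y \near p, differentiable F y) -> 'D_v F p = 0.
Proof.
move=> Fp dF.
have [r r0 Hr] := near_line v (filterI Fp dF).
have pE : p = p + (0 : R) *: v by rewrite scale0r addr0.
rewrite [in LHS]pE.
have d0 : derivable F (p + (0 : R) *: v) v.
  by apply: diff_derivable; apply: (Hr 0 _).2; rewrite normr0 ltW.
have [_ <-] := is_derive_line d0.
have [||||_ ->] := @derive1_at_max R (fun s => F (p + s *: v)) (- r) r 0; last by [].
- by rewrite -subr_ge0 opprK addr_ge0 ?ltW.
- move=> t; rewrite in_itv /= => /andP[t1 t2].
  have dt : derivable F (p + t *: v) v.
    by apply: diff_derivable; apply: (Hr t _).2; rewrite ler_norml !ltW.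
  by case: (is_derive_line dt).
- by rewrite in_itv /= oppr_lt0 r0.
- move=> t; rewrite in_itv /= => /andP[t1 t2].
  by rewrite -pE; apply: (Hr t _).1; rewrite ler_norml !ltW.
Qed.

(** Otherwise ['D_v F], which vanishes at [p], would be positive at [p + c *: v] for all small c >
    0, and the mean value theorem would make [F] exceed [F p] along the line. This asks for one
    derivative of ['D_v F] at [p] and no Taylor expansion. *)
Lemma local_max_derive2 F p v : (\forall y \near p, F y <= F p) ->
  (\forall y \near p, differentiable F y) ->
  derivable ('D_v F : V -> R^o) p v -> 'D_v ('D_v F : V -> R^o) p <= 0.
Proof.
move=> Fp dF ddF; rewrite leNgt; apply/negP => m0.
have D0 := local_max_derive v Fp dF.
have [r r0 Hr] := near_line v (filterI Fp dF).
have : (fun h : R => h^-1 *: (('D_v F \o shift p) (h *: v) - 'D_v F p)) @ 0^' -->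
   ('D_v ('D_v F : V -> R^o) p : R^o) by exact: ddF.
move=> /cvgr_gt /(_ _ m0) => /nbhs_ballP [e /= e0 eP].
pose s := Num.min r (e / 2).
have s0 : 0 < s by rewrite lt_min r0 divr_gt0.
have sr : s <= r by rewrite ge_min lexx.
have se : s < e.
  rewrite (@le_lt_trans _ _ (e / 2)) ?ge_min ?lexx ?orbT//.
  by rewrite ltr_pdivrMr// mulr_natr mulr2n ltrDl.
have [t /andP[t0 ts]|c /andP[c0 cs] Fc] := @line_MVT F p v s s0.
  apply: diff_derivable; apply: (Hr t _).2.
  by rewrite ger0_norm// (le_trans ts).
have Fs : F (p + s *: v) <= F p by apply: (Hr s _).1; rewrite gtr0_norm.
have : 0 < c^-1 *: (('D_v F \o shift p) (c *: v) - 'D_v F p).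
  apply: eP; last by rewrite gt_eqF.
  by rewrite -ball_normE /= sub0r normrN gtr0_norm// (lt_trans cs).
rewrite /= D0 subr0 [_ *: _]mulrC pmulr_lgt0 ?invr_gt0// addrC => Dc.
have : 0 < F (p + s *: v) - F p by rewrite Fc mulr_gt0.
by rewrite subr_gt0 ltNge Fs.
Qed.

Lemma near_plane y v w (P : set V) : (\near y, P y) ->
  exists2 r : R, 0 < r & forall s t, 0 <= s <= r -> 0 <= t <= r ->
    P (y + s *: v + t *: w).
Proof.
move=> /nbhs_ballP [e /= e0 eP].
have K0 : 0 < `|v| + `|w| + 1 by rewrite ltr_wpDl// addr_ge0.
(* The summand 1 keeps the divisor positive when v = w = 0 and makes the final bound strict. *)
exists (e / (`|v| + `|w| + 1)) => [|s t /andP[s0 s1] /andP[t0 t1]].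
  exact: divr_gt0.
apply: eP; rewrite -ball_normE /= -addrA opprD addrA subrr sub0r normrN.
apply: le_lt_trans (ler_normD _ _) _; rewrite !normrZ !ger0_norm//.
apply: (@le_lt_trans _ _ (e / (`|v| + `|w| + 1) * (`|v| + `|w|))).
  by rewrite mulrDr lerD// ler_wpM2r.
by rewrite mulrAC ltr_pdivrMr// ltr_pM2l// ltrDl.
Qed.

Lemma is_derive_shiftV F y v w : derivable F (y + w) v ->
  is_derive y v ((fun z => F (z + w)) : V -> R^o) ('D_v F (y + w)).
Proof.
have E : (fun h : R => h^-1 *: (((fun z => F (z + w)) \o shift y) (h *: v) - F (y + w)))
  = (fun h : R => h^-1 *: ((F \o shift (y + w)) (h *: v) - F (y + w))).
  by apply/funext => h /=; rewrite addrA.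
by move=> dF; split; rewrite /derivable /derive E.
Qed.

(* The second difference F(y+sv+sw) - F(y+sv) - F(y+sw) + F(y) is s^2 times a
   value of each of the two mixed derivatives near y. *)
Lemma mixed_derivative F y v w :
  (\forall z \near y, differentiable F z) ->
  (\forall z \near y, differentiable ('D_v F : V -> R^o) z) ->
  {for y, continuous ('D_w ('D_v F : V -> R^o) : V -> R^o)} ->
  forall e : R, 0 < e -> exists2 r : R, 0 < r & forall s, 0 < s <= r ->
    `|'D_w ('D_v F : V -> R^o) y - (F (y + s *: v + s *: w) - F (y + s *: v)
       - F (y + s *: w) + F y) / s ^+ 2| < e.
Proof.
move=> dF ddF cF e e0.
have {}cF : \forall z \near y,
    `|'D_w ('D_v F : V -> R^o) y - 'D_w ('D_v F : V -> R^o) z| < e.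
  by move/cvgrPdist_lt : cF => /(_ _ e0).
have [r r0 Hr] := near_plane v w (filterI cF (filterI dF ddF)).
exists r => // s /andP[s0 sr].
have sI : 0 <= s <= r by rewrite ltW.
have rI : (0 : R) <= 0 <= r by rewrite lexx ltW.
(* The second difference is [Q (y + s *: v) - Q y]. A mean value step for [Q] along [v], then one
   for ['D_v F] along [w], each produce a factor [s]. *)
pose Q := (fun z => F (z + s *: w)) - F : V -> R^o.
have dQ t : 0 <= t <= s ->
    derivable Q (y + t *: v) v /\
    'D_v Q (y + t *: v) = 'D_v F (y + t *: v + s *: w) - 'D_v F (y + t *: v).
  move=> /andP[t0 ts]; have tI : 0 <= t <= r by rewrite t0 (le_trans ts).
  have d0 : derivable F (y + t *: v + s *: w) v.
    by apply: diff_derivable; apply: (Hr t s tI sI).2.1.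
  have [d1 e1] := is_derive_shiftV d0.
  have d2 : derivable F (y + t *: v) v.
    apply: diff_derivable; rewrite -[X in differentiable _ X]addr0.
    rewrite -[X in _ + X](scale0r w).
    by apply: (Hr t 0 tI rI).2.1.
  by split; [exact: (derivableB d1 d2)|rewrite (deriveB d1 d2) e1].
have [t ts|c /andP[c0 cs] Qc] := @line_MVT Q y v s s0; first exact: (dQ t ts).1.
have cI : 0 <= c <= r by rewrite ltW//= (le_trans (ltW cs)).
rewrite (dQ c _).2 in Qc; last by rewrite !ltW.
have [t ts|d /andP[d0 ds] Qd] :=
   @line_MVT ('D_v F : V -> R^o) (y + c *: v) w s s0.
  by apply: diff_derivable; apply: (Hr c t cI _).2.2; case/andP: ts => -> /le_trans ->.
rewrite Qd in Qc.
have -> : F (y + s *: v + s *: w) - F (y + s *: v) - F (y + s *: w) + F y =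
    Q (y + s *: v) - Q y.
  by rewrite /Q !fctE opprB addrA [X in _ = X]addrAC.
rewrite Qc -mulrA -expr2 mulfK; last by rewrite expf_neq0// gt_eqF.
by apply: (Hr c d cI _).1; rewrite ltW//= (le_trans (ltW ds)).
Qed.

(** Exchanging [v] and [w] leaves the second difference unchanged, so both mixed derivatives lie
    within e / 2 of the same quotient, for every e > 0. *)
Lemma derive_sym F y v w :
  (\forall z \near y, differentiable F z) ->
  (\forall z \near y, differentiable ('D_v F : V -> R^o) z) ->
  (\forall z \near y, differentiable ('D_w F : V -> R^o) z) ->
  {for y, continuous ('D_w ('D_v F : V -> R^o) : V -> R^o)} ->
  {for y, continuous ('D_v ('D_w F : V -> R^o) : V -> R^o)} ->
  'D_w ('D_v F : V -> R^o) y = 'D_v ('D_w F : V -> R^o) y.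
Proof.
move=> dF dv dw cv cw; apply/eqP; rewrite -subr_eq0 -normr_le0.
apply/ler_addgt0Pl => e e0; rewrite addr0.
have e2 : 0 < e / 2 by rewrite divr_gt0.
have [r r0 Hr] := mixed_derivative dF dv cv e2.
have [r' r0' Hr'] := mixed_derivative dF dw cw e2.
pose s := Num.min r r'.
have s0 : 0 < s by rewrite lt_min r0.
have := Hr s; rewrite s0 ge_min lexx => /(_ isT) H1.
have := Hr' s; rewrite s0 ge_min lexx orbT => /(_ isT) H2.
rewrite [y + s *: w + s *: v]addrAC [X in X + F y]addrAC in H2.
set D1 := 'D_w _ _ in H1 *; set D2 := 'D_v _ _ in H2 *.
set q := (X in `|D1 - X|) in H1.
rewrite -/q distrC in H2.
have -> : D1 - D2 = (D1 - q) + (q - D2) by rewrite addrA subrK.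
by rewrite (le_trans (ler_normD _ _))// (splitr e) lerD// ltW.
Qed.

End Line.

(** * The strong maximum principle *)

Section PosDef.
Variable R : realType.

Definition posdef n (A : 'M[R]_n) : Prop :=
  forall v : 'rV[R]_n, v != 0 -> 0 < (v *m A *m v^T) 0 0.

Lemma posdef_unitmx n (A : 'M[R]_n) : posdef A -> A \in unitmx.
Proof.
move=> pA; rewrite -row_free_unit -kermx_eq0; apply/eqP/row_matrixP => i.
apply/eqP; rewrite row0; apply/negPn/negP => /pA.
by rewrite -row_mul mulmx_ker row0 mul0mx mxE ltxx.
Qed.

(** The value of the inverse form at v is the value of [A] at v A^-1. *)
Lemma posdef_invmx n (A : 'M[R]_n) : A^T = A -> posdef A -> posdef (invmx A).
Proof.
move=> sA pA v v0; have uA := posdef_unitmx pA.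
have : v *m invmx A != 0.
  by apply: contra_neq v0 => /(congr1 (mulmx^~ A)); rewrite mulmxKV// mul0mx.
by move=> /pA; rewrite trmx_mul trmx_inv sA mulmxKV// mulmxA.
Qed.

(** Cholesky factorisation, by induction on the size: the top left entry is positive and its Schur
    complement is again positive definite. It stands in for diagonalisation in [posdef_contract]. *)
Lemma posdef_gram n (A : 'M[R]_n) : A^T = A -> posdef A ->
  exists P : 'M[R]_n, A = P^T *m P.
Proof.
elim: n => [|n IHn] in A *; first by move=> _ _; exists 0; apply/matrixP => -[].
rewrite -[n.+1]/(1 + n)%N in A *; rewrite -(submxK A).
set a := ulsubmx A; set r := ursubmx A; set r' := dlsubmx A; set D := drsubmx A.
rewrite tr_block_mx => /eq_block_mx[_ _ rE sD] pA.
have {rE} r'E : r' = r^T by [].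
rewrite {}r'E in pA *.
have a0 : 0 < a 0 0.
  have n0 : row_mx 1%:M 0 != 0 :> 'rV[R]_(1 + n).
    apply/negP => /eqP/(congr1 lsubmx); rewrite row_mxKl linear0 => /matrixP/(_ 0 0).
    by rewrite !mxE/= => /eqP; rewrite oner_eq0.
  have := pA _ n0; rewrite mul_row_block tr_row_mx mul_row_col !mul1mx !mul0mx !addr0.
  by rewrite trmx1 mulmx1 trmx0 mulmx0 addr0.
have aE : a = (a 0 0)%:M by rewrite [LHS]mx11_scalar.
move: aE a0; set x := a 0 0 => aE a0.
have x0 : x != 0 by rewrite gt_eqF.
pose S := D - x^-1 *: (r^T *m r).
have sS : S^T = S by rewrite /S linearB linearZ /= trmx_mul trmxK sD.
have pS : posdef S.
  (* This [w] completes the square: its first coordinate cancels the mixed terms, so the form of [A]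
     at [w] is the form of [S] at [v]. *)
  move=> v v0; pose w : 'rV[R]_(1 + n) := row_mx (- x^-1 *: (v *m r^T)) v.
  have w0 : w != 0.
    by apply: contra_neq v0 => /(congr1 rsubmx); rewrite row_mxKr linear0.
  have := pA w w0; rewrite mul_row_block tr_row_mx mul_row_col aE.
  rewrite mul_mx_scalar scalerA mulrN mulfV// scaleN1r addNr mul0mx add0r.
  by rewrite -scalemxAl scaleNr addrC -mulmxA scalemxAr -mulmxBr.
have [Q SE] := IHn S sS pS.
exists (block_mx (Num.sqrt x)%:M ((Num.sqrt x)^-1 *: r) 0 Q).
have q0 : Num.sqrt x != 0 by rewrite gt_eqF// sqrtr_gt0.
have qq : Num.sqrt x * Num.sqrt x = x by rewrite -expr2 sqr_sqrtr// ltW.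
rewrite tr_block_mx mulmx_block trmx0 !mul0mx !mulmx0 !addr0 tr_scalar_mx.
rewrite -SE /S aE -scalar_mxM qq mul_scalar_mx scalerA mulfV// scale1r.
rewrite linearZ /= mul_mx_scalar scalerA mulfV// scale1r.
by rewrite -scalemxAl -scalemxAr scalerA -invfM qq addrC subrK.
Qed.

(** Writing A = P^T P turns the double sum into the sum of the values of the form [B] on the rows of
    P. *)
Lemma posdef_contract n (A B : 'M[R]_n) : A^T = A -> posdef A ->
  (forall v : 'rV[R]_n, (v *m B *m v^T) 0 0 <= 0) ->
  \sum_a \sum_b A a b * B a b <= 0.
Proof.
move=> sA /(posdef_gram sA)[P ->] nB.
have -> : \sum_a \sum_b (P^T *m P) a b * B a b =
   \sum_k (row k P *m B *m (row k P)^T) 0 0.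
  transitivity (\sum_a \sum_b \sum_k P k a * B a b * P k b).
    apply: eq_bigr => a _; apply: eq_bigr => b _; rewrite !mxE mulr_suml.
    by apply: eq_bigr => k _; rewrite !mxE mulrAC.
  transitivity (\sum_k \sum_b \sum_a P k a * B a b * P k b).
    rewrite exchange_big /=; under eq_bigr do rewrite exchange_big /=.
    by rewrite exchange_big.
  apply: eq_bigr => k _; rewrite !mxE; apply: eq_bigr => b _.
  by rewrite !mxE mulr_suml; apply: eq_bigr => a _; rewrite !mxE.
by rewrite -oppr_ge0 -sumrN sumr_ge0// => k _; rewrite oppr_ge0.
Qed.

End PosDef.

Section SecondOrder.
Variables (R : realType) (n : nat).
Implicit Types (F : 'rV[R]_n -> R) (p z y : 'rV[R]_n).

Lemma local_max_elliptic (A : 'M[R]_n) F p : A^T = A -> posdef A ->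
  (\forall y \near p, F y <= F p) ->
  (\forall y \near p, differentiable (F : 'rV[R]_n -> R^o) y) ->
  (forall b, differentiable (pd b F : 'rV[R]_n -> R^o) p) ->
  (forall b, pd b F p = 0) /\ \sum_a \sum_b A a b * pd a (pd b F) p <= 0.
Proof.
move=> sA pA mF dF ddF; split => [b|]; first exact: local_max_derive.
pose B := \matrix_(a, b) pd a (pd b F) p.
have -> : \sum_a \sum_b A a b * pd a (pd b F) p = \sum_a \sum_b A a b * B a b.
  by under [RHS]eq_bigr do under eq_bigr do rewrite mxE.
apply: posdef_contract => // v.
(* The expansion in partial derivatives holds where [F] is differentiable, hence on a neighbourhood
   of [p], as differentiating it once more requires. *)
have E : \near p, 'D_v (F : 'rV[R]_n -> R^o) p = \sum_b v 0 b * pd b F p.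
  by apply: filterS dF => y dFy; rewrite dirder.
have dS b : differentiable ((fun y => v 0 b * pd b F y) : 'rV[R]_n -> R^o) p.
  exact: differentiable_scale.
have dSum : differentiable ((fun y => \sum_b v 0 b * pd b F y) : 'rV[R]_n -> R^o) p.
  exact: differentiable_fsum.
have -> : (v *m B *m v^T) 0 0 = 'D_v ('D_v (F : 'rV[R]_n -> R^o) : _ -> R^o) p.
  rewrite (near_eq_derive _ E) dirder// mxE.
  under eq_bigr do rewrite !mxE mulr_suml.
  rewrite exchange_big; apply: eq_bigr => a _; rewrite pd_sum// mulr_sumr.
  apply: eq_bigr => b _; rewrite pdZ// mxE; ring.
apply: local_max_derive2 => //.
apply: (@near_eq_derivable _ _ _ (fun y => \sum_b v 0 b * pd b F y : R^o)).
  by apply: filterS E => y ->.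
exact: diff_derivable.
Qed.

End SecondOrder.

Section ContinuousArith.
Variables (R : realType) (T : topologicalType).
Implicit Types (f g : T -> R) (y : T).

Lemma continuous_const (c : R) y : {for y, continuous ((fun=> c) : T -> R)}.
Proof. exact: cvg_cst. Qed.

Lemma continuous_mul f g y : {for y, continuous f} -> {for y, continuous g} ->
  {for y, continuous (fun z => f z * g z)}.
Proof. exact: cvgM. Qed.

Lemma continuous_add f g y : {for y, continuous f} -> {for y, continuous g} ->
  {for y, continuous (fun z => f z + g z)}.
Proof. exact: cvgD. Qed.

Lemma continuous_sub f g y : {for y, continuous f} -> {for y, continuous g} ->
  {for y, continuous (fun z => f z - g z)}.
Proof. exact: cvgB. Qed.

Lemma continuous_inv f y : {for y, continuous f} -> f y != 0 ->
  {for y, continuous (fun z => (f z)^-1)}.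
Proof. by move=> cf f0; exact: cvgV. Qed.

Lemma continuous_bigsum (I : Type) (r : seq I) (F : I -> T -> R) y :
  (forall i, {for y, continuous (F i)}) ->
  {for y, continuous (fun z => \sum_(i <- r) F i z)}.
Proof.
move=> cF; elim: r => [|i r IHr].
  rewrite (_ : (fun z => _) = fun=> 0); first exact: continuous_const.
  by apply/funext => z; rewrite big_nil.
rewrite (_ : (fun z => _) = fun z => F i z + \sum_(j <- r) F j z).
  exact: continuous_add.
by apply/funext => z; rewrite big_cons.
Qed.

Lemma continuous_bigprod (I : Type) (r : seq I) (F : I -> T -> R) y :
  (forall i, {for y, continuous (F i)}) ->
  {for y, continuous (fun z => \prod_(i <- r) F i z)}.
Proof.
move=> cF; elim: r => [|i r IHr].
  rewrite (_ : (fun z => _) = fun=> 1); first exact: continuous_const.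
  by apply/funext => z; rewrite big_nil.
rewrite (_ : (fun z => _) = fun z => F i z * \prod_(j <- r) F j z).
  exact: continuous_mul.
by apply/funext => z; rewrite big_cons.
Qed.

Lemma near_eq_continuous f g y : (\near y, f y = g y) ->
  {for y, continuous f} -> {for y, continuous g}.
Proof.
move=> fg cf; have fgy : f y = g y := nbhs_singleton fg.
suff : g z @[z --> y] --> f y by rewrite fgy.
exact: cvg_trans (near_eq_cvg fg) cf.
Qed.

End ContinuousArith.

(** * Hopf's barrier in polynomial form *)

Section Barrier.
Variables (R : realType) (n : nat) (z e : 'rV[R]_n) (K : R).
Implicit Types (y : 'rV[R]_n).

(* Positive exactly inside the Euclidean ball having the segment from z to
   z + e as a diameter. *)
Definition bump y : R :=
  \sum_i ((y 0 i - z 0 i) * e 0 i - (y 0 i - z 0 i) * (y 0 i - z 0 i)).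

Definition dbump (a : 'I_n) y : R := e 0 a - 2 * (y 0 a - z 0 a).

(** Takes the place of Hopf's exponential. The square adds 2 K A(ds, ds) to the second-order part,
    while the value at [z] stays 0 and the sign stays that of [bump] as long as 1 + K [bump] > 0. *)
Definition barrier y : R := bump y + K * (bump y * bump y).

Let x i y : R := y 0 i - z 0 i.

Let dx i y : differentiable (x i : 'rV[R]_n -> R^o) y.
Proof. by apply: differentiable_add => //; exact: differentiable_coordinate. Qed.

Let pdx a i y : pd a (x i) y = (a == i)%:R.
Proof.
rewrite pdD//; last exact: differentiable_coordinate.
by rewrite pd_coordinate pd_const addr0.
Qed.

Let term i y : R := x i y * e 0 i - x i y * x i y.

Let termE i : term i = fun y => e 0 i * x i y + -1 * (x i y * x i y).
Proof. by apply/funext => y; rewrite /term mulrC mulN1r. Qed.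

Let dterm i y : differentiable (term i : 'rV[R]_n -> R^o) y.
Proof.
rewrite termE; apply: differentiable_add; apply: differentiable_scale => //.
exact: differentiable_scalarM.
Qed.

Let pdterm a i y : pd a (term i) y = (a == i)%:R * dbump i y.
Proof.
have dM := differentiable_scalarM (@dx i y) (@dx i y).
rewrite termE pdD ?pdZ ?pdM//; try exact: differentiable_scale.
by rewrite !pdx /dbump /x; ring.
Qed.

Lemma differentiable_bump y : differentiable (bump : 'rV[R]_n -> R^o) y.
Proof. by apply: (@differentiable_fsum _ _ _ term) => i; exact: dterm. Qed.

Lemma pd_bump a y : pd a bump y = dbump a y.
Proof.
rewrite /bump (@pd_sum _ _ _ _ term)// (bigD1 a)//= pdterm eqxx mul1r big1 ?addr0// => i ia.
by rewrite pdterm eq_sym (negPf ia) mul0r.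
Qed.

Lemma differentiable_dbump a y : differentiable (dbump a : 'rV[R]_n -> R^o) y.
Proof.
rewrite (_ : dbump a = fun y => e 0 a + -2 * x a y); last first.
  by apply/funext => w; rewrite /dbump mulNr.
by apply: differentiable_add; [exact: differentiable_const|exact: differentiable_scale].
Qed.

Lemma pd_dbump a b y : pd a (dbump b) y = -2 * (a == b)%:R.
Proof.
rewrite (_ : dbump b = fun y => e 0 b + -2 * x b y); last first.
  by apply/funext => w; rewrite /dbump mulNr.
rewrite pdD//; last exact: differentiable_scale.
by rewrite pd_const add0r pdZ// pdx.
Qed.

Lemma differentiable_barrier y : differentiable (barrier : 'rV[R]_n -> R^o) y.
Proof.
have ds := @differentiable_bump.
apply: differentiable_add => //; apply: differentiable_scale => //.
exact: differentiable_scalarM.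
Qed.

Lemma pd_barrier a : pd a barrier = fun y => (1 + 2 * K * bump y) * dbump a y.
Proof.
apply/funext => y; have ds := differentiable_bump y.
have dM := differentiable_scalarM ds ds.
rewrite pdD ?pdZ ?pdM//; last exact: differentiable_scale.
by rewrite pd_bump; ring.
Qed.

Lemma differentiable_pd_barrier a y :
  differentiable (pd a barrier : 'rV[R]_n -> R^o) y.
Proof.
rewrite pd_barrier; apply: differentiable_scalarM; last exact: differentiable_dbump.
by apply: differentiable_add => //; apply: differentiable_scale; exact: differentiable_bump.
Qed.

Lemma pd2_barrier a b y : pd a (pd b barrier) y =
  2 * K * (dbump a y * dbump b y) - 2 * (1 + 2 * K * bump y) * (a == b)%:R.
Proof.
have ds := differentiable_bump y; have dd := differentiable_dbump b y.
have dK : differentiable ((fun y => 1 + 2 * K * bump y) : 'rV[R]_n -> R^o) y.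
  by apply: differentiable_add => //; exact: differentiable_scale.
rewrite pd_barrier pdM// pd_dbump pdD//; last exact: differentiable_scale.
by rewrite pd_const pdZ// pd_bump; ring.
Qed.

Lemma bump_center : bump z = 0.
Proof. by rewrite /bump big1// => i _; rewrite subrr !mul0r subr0. Qed.

Lemma barrier_center : barrier z = 0.
Proof. by rewrite /barrier bump_center !mulr0 addr0. Qed.

Lemma dbump_center a : dbump a z = e 0 a.
Proof. by rewrite /dbump subrr mulr0 subr0. Qed.

End Barrier.

Section Operator.
Variables (R : realType) (n : nat).
Implicit Types (F G : 'rV[R]_n -> R) (y z : 'rV[R]_n) (A : 'M[R]_n) (b : 'rV[R]_n).

Definition elliptic A b F y : R :=
  \sum_i \sum_j A i j * pd i (pd j F) y + \sum_i b 0 i * pd i F y.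

Lemma elliptic_add A b F G (e : R) y :
  (\forall z \near y, differentiable (F : 'rV[R]_n -> R^o) z) ->
  (\forall z \near y, differentiable (G : 'rV[R]_n -> R^o) z) ->
  (forall i, differentiable (pd i F : 'rV[R]_n -> R^o) y) ->
  (forall i, differentiable (pd i G : 'rV[R]_n -> R^o) y) ->
  elliptic A b (fun z => F z + e * G z) y = elliptic A b F y + e * elliptic A b G y.
Proof.
move=> dF dG ddF ddG.
have E1 i : \near y, pd i (fun z => F z + e * G z) y = pd i F y + e * pd i G y.
  near=> z; rewrite pdD; [|by near: z|by apply: differentiable_scale; near: z].
  by congr (_ + _); rewrite pdZ//; near: z.
have E2 i j : pd i (pd j (fun z => F z + e * G z)) y =
    pd i (pd j F) y + e * pd i (pd j G) y.
  by rewrite (pd_ext _ (E1 j)) pdD// ?pdZ//; exact: differentiable_scale.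
rewrite /elliptic.
rewrite mulrDr addrACA; congr (_ + _).
  rewrite mulr_sumr -big_split; apply: eq_bigr => i _ /=.
  rewrite mulr_sumr -big_split; apply: eq_bigr => j _ /=; rewrite E2.
  by rewrite mulrDr mulrCA.
rewrite mulr_sumr -big_split; apply: eq_bigr => i _ /=.
by rewrite (nbhs_singleton (E1 i)) mulrDr mulrCA.
Unshelve. all: by end_near. Qed.

(* For K large, L(s + K s^2) = (1 + 2 K s) L s + 2 K A(ds, ds) is positive at z
   since s(z) = 0 and ds(z) = e <> 0. *)
Lemma barrier_strict (A : 'rV[R]_n -> 'M[R]_n) (b : 'rV[R]_n -> 'rV[R]_n) z e :
  (forall i j, {for z, continuous (fun y => A y i j)}) ->
  (forall i, {for z, continuous (fun y => b y 0 i)}) ->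
  posdef (A z) -> e != 0 ->
  exists2 K : R, 0 <= K & \forall y \near z, 0 < elliptic (A y) (b y) (barrier z e K) y.
Proof.
move=> cA cb pA e0.
pose q (y : 'rV[R]_n) := \sum_i \sum_j A y i j * (dbump z e i y * dbump z e j y).
pose t (y : 'rV[R]_n) := -2 * (\sum_i A y i i) + \sum_i b y 0 i * dbump z e i y.
have LE K y : elliptic (A y) (b y) (barrier z e K) y =
    2 * K * q y + (1 + 2 * K * bump z e y) * t y.
  rewrite /elliptic; under [X in _ + X]eq_bigr do rewrite pd_barrier.
  have pdE i j := pd2_barrier z e K i j y.
  move: (bump z e y) pdE => s pdE.
  rewrite /t mulrDr addrA; congr (_ + _).
    rewrite mulrA /q !mulr_sumr -big_split; apply: eq_bigr => i _ /=.
    under eq_bigr do rewrite pdE mulrBr.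
    rewrite big_split /= mulr_sumr; congr (_ + _).
      by apply: eq_bigr => j _; ring.
    rewrite (bigD1 i)//= eqxx mulr1 big1 ?addr0; first by ring.
    by move=> j /negPf ij; rewrite eq_sym ij !mulr0 oppr0.
  by rewrite mulr_sumr; apply: eq_bigr => i _; ring.
have cs : {for z, continuous (bump z e)}.
  exact: (differentiable_continuous (differentiable_bump z e z)).
have cd i : {for z, continuous (dbump z e i)}.
  exact: (differentiable_continuous (differentiable_dbump z e i z)).
have cq : {for z, continuous q}.
  apply: continuous_bigsum => i; apply: continuous_bigsum => j.
  by apply: continuous_mul; [exact: cA|apply: continuous_mul; exact: cd].
have ct : {for z, continuous t}.
  apply: continuous_add.
    apply: continuous_mul; first exact: continuous_const.
    by apply: continuous_bigsum => i; exact: cA.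
  by apply: continuous_bigsum => i; apply: continuous_mul; [exact: cb|exact: cd].
have qz : 0 < q z.
  rewrite (_ : q z = (e *m A z *m e^T) 0 0); first exact: pA.
  rewrite mxE /q exchange_big; apply: eq_bigr => j _ /=.
  rewrite !mxE mulr_suml; apply: eq_bigr => i _; rewrite !dbump_center; ring.
(* With this choice the value at [z] is 2 |t| + q + t, which is at least q > 0; the summand 1 / 2 is
   what supplies q. Continuity of the coefficients spreads the sign to a neighbourhood. *)
pose K := `|t z| / q z + 1 / 2.
have K0 : 0 <= K by rewrite addr_ge0// divr_ge0// ltW.
exists K => //.
pose L y := 2 * K * q y + (1 + 2 * K * bump z e y) * t y.
have cL : {for z, continuous L}.
  apply: continuous_add; first by apply: continuous_mul => //; exact: continuous_const.
  apply: continuous_mul => //; apply: continuous_add; first exact: continuous_const.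
  by apply: continuous_mul => //; exact: continuous_const.
have Lz : 0 < L z.
  rewrite /L bump_center mulr0 addr0 mul1r /K.
  have -> : 2 * (`|t z| / q z + 1 / 2) * q z = 2 * `|t z| + q z.
    by field; rewrite gt_eqF.
  have := ler_norm (- t z); rewrite normrN => H.
  have := normr_ge0 (t z); lra.
have : \forall y \near z, 0 < L y by exact: (cvgr_gt _ cL _ Lz).
by apply: filterS => y; rewrite LE.
Qed.

End Operator.

Lemma norm_sub_continuous (R : realType) (V : normedModType R) (y : V) :
  continuous (fun z => `|y - z| : R).
Proof.
by move=> z; apply: cvg_norm; apply: cvgB; [exact: cvg_cst|exact: cvg_id].
Qed.

Section MaximumPrinciple.
Variables (R : realType) (n : nat).
Implicit Types (y z : 'rV[R]_n).

(** The norm on row vectors is the maximum norm, so coordinate bounds drawn from a Euclidean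
    distance control it. *)
Lemma rV_norm_le y (c : R) : 0 <= c -> (forall i, `|y 0 i| <= c) -> `|y| <= c.
Proof.
move=> c0 yc; rewrite [leLHS]/Num.Def.normr/= mx_normrE; apply: bigmax_le => //.
by case=> i j _ /=; rewrite ord1.
Qed.

Lemma near_closed_ball y (P : set 'rV[R]_n) : (\near y, P y) ->
  exists2 r : R, 0 < r & forall z, `|y - z| <= r -> P z.
Proof.
move=> /nbhs_ballP [e /= e0 eP]; exists (e / 2); first by rewrite divr_gt0.
move=> t te; apply: eP; rewrite -ball_normE /=.
by rewrite (le_lt_trans te)// ltr_pdivrMr// mulr_natr mulr2n ltrDl.
Qed.

Lemma compact_in_ball y (r : R) (C : set 'rV[R]_n) :
  closed C -> (forall z, C z -> `|y - z| <= r) -> compact C.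
Proof.
move=> cC Cr; apply: bounded_closed_compact => //.
exists (`|y| + r); split; first exact: num_real.
move=> t /ltW Mt z /Cr zr; apply: le_trans Mt.
rewrite -[z](subKr y) (le_trans (ler_normB _ _))//.
by rewrite lerD2l.
Qed.

(** Continuity is asked at points of [C] only, because the functions at hand are controlled only
    inside a chart image: a limit point is first placed in [C] and then tested against [P]. *)
Lemma closed_level (C : set 'rV[R]_n) (F : 'rV[R]_n -> R) (P : set R) :
  closed C -> closed P -> (forall y, C y -> {for y, continuous F}) ->
  closed [set y | C y /\ P (F y)].
Proof.
move=> cC cP cF y yK.
have Cy : C y by apply: cC => B /yK [z [[Cz _] Bz]]; exists z.
split=> //; apply: cP => B /(cF y Cy) /yK [z [[_ Pz] Bz]].
by exists (F z).
Qed.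

Lemma within_continuous (C : set 'rV[R]_n) (F : 'rV[R]_n -> R) :
  (forall y, C y -> {for y, continuous F}) -> {within C, continuous F}.
Proof.
move=> cF; apply: continuous_in_subspaceT => y; rewrite inE; exact: cF.
Qed.

Section Subsolution.
Variables (W : set 'rV[R]_n) (F : 'rV[R]_n -> R) (M : R).
Variables (A : 'rV[R]_n -> 'M[R]_n) (b : 'rV[R]_n -> 'rV[R]_n).
Hypothesis oW : open W.
Hypothesis dF : forall y, W y -> differentiable (F : 'rV[R]_n -> R^o) y.
Hypothesis ddF : forall i y, W y -> differentiable (pd i F : 'rV[R]_n -> R^o) y.
Hypothesis cA : forall i j y, W y -> {for y, continuous (fun z => A z i j)}.
Hypothesis cb : forall i y, W y -> {for y, continuous (fun z => b z 0 i)}.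
Hypothesis symA : forall y, W y -> (A y)^T = A y.
Hypothesis posA : forall y, W y -> posdef (A y).
Hypothesis subF : forall y, W y -> 0 <= elliptic (A y) (b y) F y.
Hypothesis FM : forall y, W y -> F y <= M.

Let cF y : W y -> {for y, continuous F}.
Proof. by move=> Wy; exact: (differentiable_continuous (dF Wy)). Qed.

(* Otherwise F + ep * barrier, for ep small, would be below M on the boundary of
   a small ball around z while it equals M at z: an interior maximum at which
   its image under the elliptic operator is positive. *)
Lemma hopf_touching z e : W z -> F z = M -> e != 0 ->
  (\forall y \near z, y != z -> 0 <= bump z e y -> F y < M) -> False.
Proof.
move=> Wz Fz e0 touch.
have [K K0 Lv] := barrier_strict (fun i j => @cA i j z Wz) (fun i => @cb i z Wz) (posA Wz) e0.
set v := barrier z e K in Lv.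
have cs y : {for y, continuous (bump z e)}.
  exact: (differentiable_continuous (differentiable_bump z e y)).
have cv y : {for y, continuous v}.
  exact: (differentiable_continuous (differentiable_barrier z e K y)).
have Ks : \forall y \near z, 0 < 1 + K * bump z e y.
  have : {for z, continuous (fun y => 1 + K * bump z e y)}.
    apply: continuous_add; first exact: continuous_const.
    by apply: continuous_mul; [exact: continuous_const|exact: cs].
  by move=> /cvgr_gt; apply; rewrite bump_center mulr0 addr0.
have Wn : \forall y \near z, W y by exact: open_nbhs_nbhs.
have [d d0 Hd] := near_closed_ball (filterI (filterI Wn touch) (filterI Lv Ks)).
have HW y : `|z - y| <= d -> W y by move=> /Hd [[]].
have cD : closed [set y | `|z - y| <= d].
  have := closed_level closedT (@closed_le _ d) (fun y _ => @norm_sub_continuous _ _ z y).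
  by rewrite (_ : [set y | _] = [set y | `|z - y| <= d])//; apply/seteqP; split=> y // [].
have cS : closed [set y | `|z - y| = d].
  have := closed_level closedT (@closed_eq _ d) (fun y _ => @norm_sub_continuous _ _ z y).
  by rewrite (_ : [set y | _] = [set y | `|z - y| = d])//; apply/seteqP; split=> y // [].
(* The sphere is split by the sign of [bump]: on [C] the touching hypothesis gives F < M, on the
   rest the barrier itself is negative. Sphere and ball are those of the maximum norm; their shape
   does not enter. *)
pose C := [set y | `|z - y| = d /\ 0 <= bump z e y].
have cC : closed C.
  by apply: (@closed_level _ _ [set x | 0 <= x] cS) => //; exact: closed_ge.
have kC : compact C by apply: (@compact_in_ball z d) => // y [-> _].
have CM y : C y -> F y < M.
  move=> [yd ys]; have [|[_ H] _] := Hd y; first by rewrite yd.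
  apply: H => //; apply: contra_eq_neq yd => ->.
  by rewrite subrr normr0 lt_eqF.
have [ep ep0 Hep] : exists2 ep : R, 0 < ep & forall y, C y -> F y + ep * v y < M.
  have [C0|/set0P/negP/negPn/eqP C0] := pselect (C !=set0); last first.
    by exists 1 => // y; rewrite C0.
  have [|c Cc Fc] := compact_EVT_max C0 kC (_ : {within C, continuous F}).
    by apply: within_continuous => y [yd _]; apply: cF; apply: HW; rewrite yd.
  have [|c' _ vc] := compact_EVT_max C0 kC (_ : {within C, continuous v}).
    by apply: within_continuous => y _; exact: cv.
  rewrite inE in Cc; have Fc0 := CM _ Cc.
  pose B := `|v c'| + 1; have B0 : 0 < B by rewrite ltr_wpDl.
  (* [B] bounds [v] from above on [C], so the perturbation uses up at most half of the gap between
     [F c], the maximum of [F] on [C], and [M]. *)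
  exists ((M - F c) / (2 * B)); first by rewrite divr_gt0 ?subr_gt0 ?mulr_gt0.
  move=> y Cy; have /Fc Fy : y \in C by rewrite inE.
  have /vc vy : y \in C by rewrite inE.
  have vB : v y <= B.
    by rewrite (le_trans vy)// (le_trans (ler_norm _))// lerDl.
  apply: (@le_lt_trans _ _ (F c + (M - F c) / (2 * B) * B)).
    by rewrite lerD// ler_wpM2l// divr_ge0 ?subr_ge0 ?mulr_ge0 ?ltW.
  have -> : (M - F c) / (2 * B) * B = (M - F c) / 2 by field; rewrite gt_eqF.
  lra.
pose G y := F y + ep * v y.
have Gz : G z = M by rewrite /G /v barrier_center mulr0 addr0.
have GS y : `|z - y| = d -> G y < M.
  move=> yd; have [s0|s0] := leP 0 (bump z e y); first exact: Hep.
  have [|_ [_ ks]] := Hd y; first by rewrite yd.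
  have vE : v y = bump z e y * (1 + K * bump z e y) by rewrite /v /barrier; ring.
  have v0 : v y < 0 by rewrite vE pmulr_llt0.
  rewrite (@lt_le_trans _ _ (F y))//; last by apply: FM; apply: HW; rewrite yd.
  by rewrite /G gtrDl pmulr_rlt0.
have kD : compact [set y | `|z - y| <= d] by exact: (@compact_in_ball z d).
have D0 : [set y | `|z - y| <= d] !=set0 by exists z => /=; rewrite subrr normr0 ltW.
have [|p Dp Gp] := compact_EVT_max D0 kD (_ : {within _, continuous G}).
  apply: within_continuous => y /= yd; apply: continuous_add; first exact/cF/HW.
  by apply: continuous_mul; [exact: continuous_const|exact: cv].
rewrite inE /= in Dp.
(* [G] equals [M] at the centre and is smaller on the sphere, so the maximum point [p] is
   interior. *)
have zpd : `|z - p| < d.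
  rewrite lt_neqAle Dp andbT; apply/eqP => /GS; apply/negP; rewrite -leNgt -Gz.
  by apply: Gp; rewrite inE /= subrr normr0 ltW.
have Wp := HW _ Dp.
have Wnp : \forall y \near p, W y by exact: open_nbhs_nbhs.
have Gmax : \forall y \near p, G y <= G p.
  have : \forall y \near p, `|z - y| < d.
    by have := @norm_sub_continuous _ _ z p => /cvgr_lt; apply.
  by apply: filterS => y /ltW yd; apply: Gp; rewrite inE.
have dv y : differentiable (v : 'rV[R]_n -> R^o) y by exact: differentiable_barrier.
have ddv i y : differentiable (pd i v : 'rV[R]_n -> R^o) y.
  exact: differentiable_pd_barrier.
have dG : \forall y \near p, differentiable (G : 'rV[R]_n -> R^o) y.
  apply: filterS Wnp => y /dF dFy; apply: differentiable_add => //.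
  exact: differentiable_scale.
have dFn : \forall y \near p, differentiable (F : 'rV[R]_n -> R^o) y.
  by apply: filterS Wnp => y /dF.
have ddG i : differentiable (pd i G : 'rV[R]_n -> R^o) p.
  have E : \near p, pd i F p + ep * pd i v p = pd i G p.
    apply: filterS dFn => y dFy.
    by rewrite (pdD _ dFy (differentiable_scale ep (dv y))) pdZ.
  apply: (near_eq_differentiable E); apply: differentiable_add; first exact: ddF.
  exact: differentiable_scale.
have [pdG0 HG] := local_max_elliptic (symA Wp) (posA Wp) Gmax dG ddG.
have : elliptic (A p) (b p) G p <= 0.
  by rewrite /elliptic [X in _ + X]big1 ?addr0// => i _; rewrite pdG0 mulr0.
rewrite elliptic_add//; last 2 first.
- by near=> y; exact: dv.
- by move=> i; exact: ddF.
have := (Hd p Dp).2.1; rewrite leNgt => Lp.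
by rewrite ltr_wpDl ?mulr_gt0// subF.
Unshelve. all: by end_near. Qed.

(* Take the point z of the level set {F = M} nearest to a nearby point y1 where
   F < M: the ball centred at y1 touches the level set at z. *)
Lemma strong_maximum y0 : W y0 -> F y0 = M -> \forall y \near y0, F y = M.
Proof.
move=> W0 F0.
have Wn : \forall y \near y0, W y by exact: open_nbhs_nbhs.
have [r r0 HW] := near_closed_ball Wn.
(* Squared Euclidean distance rather than the norm: the touching ball must be of the kind that
   [bump] describes. *)
pose q (y1 y : 'rV[R]_n) : R := \sum_i (y 0 i - y1 0 i) * (y 0 i - y1 0 i).
have cq y1 y : {for y, continuous (q y1)}.
  apply: continuous_bigsum => i.
  have c : {for y, continuous (fun y : 'rV[R]_n => y 0 i - y1 0 i)}.
    apply: continuous_sub; last exact: continuous_const.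
    exact: (@coord_continuous _ 1 n 0 i).
  exact: continuous_mul.
have qC y1 y : q y1 y = q y y1.
  by apply: eq_bigr => i _; ring.
(* With [y1] within r / 3 of [y0] in both distances, its nearest point [z] in [K] is within r / 3 of
   [y1], hence strictly inside the ball of radius r. Points near [z] with F = M thus belong to [K]
   and compete with [z]. *)
have r3 : 0 < r / 3 by rewrite divr_gt0.
have near1 : \forall y \near y0, `|y0 - y| < r / 3.
  by have := @norm_sub_continuous _ _ y0 y0 => /cvgr_lt; apply; rewrite subrr normr0.
have near2 : \forall y \near y0, q y0 y < (r / 3) ^+ 2.
  have := cq y0 y0 => /cvgr_lt; apply; rewrite /q big1 ?exprn_gt0// => i _.
  by rewrite subrr mulr0.
have cD : closed [set y | `|y0 - y| <= r].
  have := closed_level closedT (@closed_le _ r) (fun y _ => @norm_sub_continuous _ _ y0 y).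
  by rewrite (_ : [set y | _] = [set y | `|y0 - y| <= r])//; apply/seteqP; split=> y // [].
pose K := [set y | `|y0 - y| <= r /\ F y = M].
have cK : closed K.
  apply: (@closed_level _ _ [set x | x = M] cD); first exact: closed_eq.
  by move=> y /= yr; apply: cF; exact: HW.
have kK : compact K by apply: (@compact_in_ball y0 r) => // y [].
have K0 : K !=set0 by exists y0; split=> //; rewrite subrr normr0 ltW.
apply: filterS2 near1 near2 => y1 d1 d2; apply/eqP/negPn/negP => F1.
have [|z Kz qz] := compact_EVT_min K0 kK (_ : {within K, continuous (q y1)}).
  by apply: within_continuous => y _; exact: cq.
rewrite inE in Kz; have [_ Fz] := Kz.
have qz3 : q y1 z < (r / 3) ^+ 2.
  rewrite (le_lt_trans _ d2)// [leRHS]qC; apply: qz.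
  by rewrite inE; split=> //; rewrite subrr normr0 ltW.
have z1 : `|y1 - z| <= r / 3.
  apply: rV_norm_le => [|i]; first exact: ltW.
  rewrite -(@ler_pXn2r _ 2)// ?nnegrE ?ltW// real_normK ?num_real//.
  apply: le_lt_trans qz3; rewrite /q (bigD1 i)//= !mxE -sqrrN opprB -expr2 lerDl.
  by rewrite sumr_ge0// => j _; rewrite -expr2 sqr_ge0.
have zr : `|y0 - z| < r.
  rewrite (le_lt_trans (ler_distD y1 _ _))//.
  move: d1 z1 r0; lra.
have zn : \forall y \near z, `|y0 - y| < r.
  by have := @norm_sub_continuous _ _ y0 z => /cvgr_lt; apply.
(* The ball with diameter from [z] to [y1] lies in the ball centred at [y1] through [z] and meets
   its boundary only at [z]; identity [E] below is the algebraic form of this. *)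
apply: (@hopf_touching z (y1 - z)) => //.
- exact/HW/ltW.
- by rewrite subr_eq0; apply: contra_neq F1 => ->.
apply: filterS zn => y yr yz s0.
have Wy := HW _ (ltW yr).
rewrite lt_neqAle FM// andbT; apply/eqP => Fy.
have /qz : y \in K by rewrite inE; split=> //; exact: ltW.
apply/negP; rewrite -ltNge.
pose s2 := \sum_i (y 0 i - z 0 i) * (y 0 i - z 0 i).
have E : q y1 z - q y1 y = 2 * bump z (y1 - z) y + s2.
  rewrite /q /s2 /bump mulr_sumr -sumrB -big_split; apply: eq_bigr => i _.
  rewrite !mxE /=; ring.
have s2_ge i : 0 <= (y 0 i - z 0 i) * (y 0 i - z 0 i).
  by rewrite -expr2 sqr_ge0.
have s2_gt0 : 0 < s2.
  rewrite lt_neqAle sumr_ge0 ?andbT//.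
  apply: contra_neq yz => /esym/eqP; rewrite psumr_eq0// => /allP H.
  apply/rowP => i; apply/eqP; rewrite -subr_eq0 -sqrf_eq0 expr2.
  by apply: (H i); rewrite mem_index_enum.
by rewrite -subr_gt0 E ltr_wpDl// mulr_ge0.
Qed.

End Subsolution.
End MaximumPrinciple.

(** * The Gauss formula *)

Section Christoffel.
Variables (R : realType) (m : nat).
Implicit Types (G : 'rV[R]_m -> 'M[R]_m) (y : 'rV[R]_m) (v w : 'rV[R]_m).

(* The symbol of the first kind: all three indices are lower. *)
Definition christoffel1 G (a b c : 'I_m) y : R :=
  2^-1 * (pd a (fun z => G z b c) y + pd b (fun z => G z a c) y
          - pd c (fun z => G z a b) y).

Lemma christoffel_lower G a b e y : (G y)^T = G y -> G y \in unitmx ->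
  \sum_c christoffel G a b c y * G y c e = christoffel1 G a b e y.
Proof.
move=> sG uG; rewrite /christoffel /christoffel1.
under eq_bigr do rewrite -mulrA mulr_suml.
rewrite -mulr_sumr; congr (_ * _); rewrite exchange_big /=.
transitivity (\sum_j (G y *m invmx (G y)) e j *
    (pd a (fun z => G z b j) y + pd b (fun z => G z a j) y - pd j (fun z => G z a b) y)).
  apply: eq_bigr => j _; rewrite mxE mulr_suml; apply: eq_bigr => c _.
  have -> : G y c e = G y e c by rewrite -{1}sG mxE.
  ring.
rewrite mulmxV// (bigD1 e)//= mxE eqxx mul1r big1 ?addr0// => j /negPf je.
by rewrite mxE eq_sym je mul0r.
Qed.

Lemma pd_symmx G (a b c : 'I_m) y : (\near y, (G y)^T = G y) ->
  pd a (fun z => G z b c) y = pd a (fun z => G z c b) y.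
Proof. by move=> sG; apply: pd_ext; apply: filterS sG => z {1}<-; rewrite mxE. Qed.

Lemma christoffel_sym G a b c y : (\near y, (G y)^T = G y) ->
  christoffel G a b c y = christoffel G b a c y.
Proof.
move=> sG; rewrite /christoffel; congr (_ * _); apply: eq_bigr => d _.
by rewrite (pd_symmx d a b sG) [X in _ * (X - _)]addrC.
Qed.

Lemma christoffel1_compat G a b c y : (\near y, (G y)^T = G y) ->
  christoffel1 G a b c y + christoffel1 G a c b y = pd a (fun z => G z b c) y.
Proof.
move=> sG; rewrite /christoffel1 (pd_symmx a c b sG); lra.
Qed.

Definition ip (G : 'M[R]_m) v w : R := (v *m G *m w^T) 0 0.

Lemma ipE (G : 'M[R]_m) v w : ip G v w = \sum_k \sum_l v 0 k * G k l * w 0 l.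
Proof.
rewrite /ip mxE exchange_big; apply: eq_bigr => l _ /=; rewrite !mxE mulr_suml.
by apply: eq_bigr => k _.
Qed.

Lemma ipDl (G : 'M[R]_m) v v' w : ip G (v + v') w = ip G v w + ip G v' w.
Proof. by rewrite /ip !mulmxDl mxE. Qed.

Lemma ipC (G : 'M[R]_m) v w : G^T = G -> ip G v w = ip G w v.
Proof.
move=> sG; rewrite /ip -[in RHS](trmxK (w *m G *m v^T)) [in RHS]mxE.
by rewrite !trmx_mul trmxK sG mulmxA.
Qed.

(** The zeroth-order part of the covariant derivative of a field [w] in the direction [v]. *)
Definition gamma G y v w : 'rV[R]_m :=
  \row_k \sum_c \sum_d christoffel G c d k y * v 0 c * w 0 d.

Lemma ip_gamma G y j v w : (G y)^T = G y -> G y \in unitmx ->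
  ip (G y) (gamma G y j v) w =
  \sum_c \sum_d \sum_l j 0 c * v 0 d * w 0 l * christoffel1 G c d l y.
Proof.
move=> sG uG; rewrite ipE exchange_big /=.
transitivity (\sum_l \sum_k \sum_c \sum_d
    j 0 c * v 0 d * w 0 l * (christoffel G c d k y * G y k l)).
  apply: eq_bigr => l _; apply: eq_bigr => k _; rewrite mxE !mulr_suml.
  apply: eq_bigr => c _; rewrite !mulr_suml; apply: eq_bigr => d _; ring.
transitivity (\sum_l \sum_c \sum_d
    j 0 c * v 0 d * w 0 l * christoffel1 G c d l y).
  apply: eq_bigr => l _; rewrite exchange_big; apply: eq_bigr => c _ /=.
  rewrite exchange_big; apply: eq_bigr => d _ /=.
  by rewrite -mulr_sumr christoffel_lower.
rewrite exchange_big; apply: eq_bigr => c _ /=; exact: exchange_big.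
Qed.

Lemma gamma_sym G y v w : (\near y, (G y)^T = G y) -> gamma G y v w = gamma G y w v.
Proof.
move=> sG; apply/rowP => k; rewrite !mxE exchange_big.
apply: eq_bigr => c _; apply: eq_bigr => d _; rewrite (christoffel_sym _ _ _ sG).
ring.
Qed.

Lemma ip_gamma_compat G y j v w : (\near y, (G y)^T = G y) -> G y \in unitmx ->
  ip (G y) (gamma G y j v) w + ip (G y) v (gamma G y j w) =
  \sum_k \sum_l v 0 k * (\sum_c j 0 c * pd c (fun z => G z k l) y) * w 0 l.
Proof.
move=> sG uG; have sGy := nbhs_singleton sG.
rewrite (ipC v) // !ip_gamma//.
transitivity (\sum_c \sum_k \sum_l
    j 0 c * v 0 k * w 0 l * pd c (fun z => G z k l) y).
  rewrite -big_split; apply: eq_bigr => c _ /=.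
  rewrite [X in _ + X]exchange_big -big_split; apply: eq_bigr => k _ /=.
  rewrite -big_split; apply: eq_bigr => l _ /=.
  by rewrite -(christoffel1_compat c k l sG); ring.
rewrite exchange_big; apply: eq_bigr => k _ /=; rewrite exchange_big.
apply: eq_bigr => l _ /=; rewrite mulr_sumr mulr_suml; apply: eq_bigr => c _.
ring.
Qed.

End Christoffel.

Section Compatibility.
Variables (R : realType) (n m : nat).
Variables (G : 'rV[R]_m -> 'M[R]_m) (U : 'rV[R]_n -> 'rV[R]_m) (y : 'rV[R]_n).
Hypothesis dU : differentiable U y.
Hypothesis dG : forall k l, differentiable ((fun z => G z k l) : 'rV[R]_m -> R^o) (U y).
Hypothesis sG : \forall z \near U y, (G z)^T = G z.
Hypothesis uG : G (U y) \in unitmx.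

(** For [V] = [U] this is a coordinate tangent vector seen as a field along [U], a form that
    [nabla_along] can differentiate again. *)
Definition pdrow (a : 'I_n) (V : 'rV[R]_n -> 'rV[R]_m) (z : 'rV[R]_n) : 'rV[R]_m :=
  \row_k pd a (fun w => V w 0 k) z.

Lemma nabla_along_row a V :
  row a (nabla_along G U V y) = pdrow a V y + gamma G (U y) (row a ('J U y)) (V y).
Proof.
apply/rowP => k; rewrite !mxE; congr (_ + _).
by apply: eq_bigr => c _; apply: eq_bigr => d _; rewrite [row a _ 0 c]mxE.
Qed.

(** The chain rule differentiates [G (U z)] through ['J U]; by metric compatibility this is exactly
    what the two Christoffel terms inside [nabla_along] contribute. *)
Lemma pd_ip a (V X : 'rV[R]_n -> 'rV[R]_m) :
  (forall k, differentiable ((fun z => V z 0 k) : 'rV[R]_n -> R^o) y) ->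
  (forall k, differentiable ((fun z => X z 0 k) : 'rV[R]_n -> R^o) y) ->
  pd a (fun z => ip (G (U z)) (V z) (X z)) y =
  ip (G (U y)) (row a (nabla_along G U V y)) (X y) +
  ip (G (U y)) (V y) (row a (nabla_along G U X y)).
Proof.
move=> dV dX; have sGy := nbhs_singleton sG.
have dGU k l : differentiable ((fun z => G (U z) k l) : 'rV[R]_n -> R^o) y.
  exact: (@differentiable_comp _ _ _ _ U (fun z => G z k l : R^o)).
rewrite !nabla_along_row (ipC (V y))// !ipDl -(ipC (V y))// -(ipC (V y))//.
rewrite addrACA ip_gamma_compat// !ipE.
under [X in pd a X y]eq_fun do rewrite ipE.
have d1 k l := differentiable_scalarM (dV k) (dGU k l).
have d2 k l := differentiable_scalarM (d1 k l) (dX l).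
rewrite pd_sum; last by move=> k; exact: differentiable_fsum.
rewrite -!big_split; apply: eq_bigr => k _ /=.
rewrite pd_sum// -!big_split; apply: eq_bigr => l _ /=.
rewrite (pdM a (d1 k l) (dX l)) (pdM a (dV k) (dGU k l)).
rewrite (@pd_comp _ _ _ U (fun z => G z k l))// !mxE.
under [X in _ = _ + _ * X * _]eq_bigr do rewrite [row a _ 0 _]mxE.
ring.
Qed.

End Compatibility.

Lemma ip_row (R : realType) n m (B : 'M[R]_(n, m)) (K : 'M[R]_m) b c :
  ip K (row b B) (row c B) = (B *m K *m B^T) b c.
Proof.
rewrite /ip -row_mul !mxE; apply: eq_bigr => k _; rewrite [row b _ 0 k]mxE.
by rewrite ![_^T _ _]mxE [row c B 0 k]mxE.
Qed.

(** Here d a b c stands for <D_a e_b, e_c> and dg a b c for the derivative of g_bc along e_a: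
    compatibility and absence of torsion determine the connection. *)
Lemma koszul (R : realFieldType) (I : Type) (d dg : I -> I -> I -> R) :
  (forall a b c, dg a b c = d a b c + d a c b) ->
  (forall a b c, d a b c = d b a c) ->
  forall a b c, d a b c = 2^-1 * (dg a b c + dg b a c - dg c a b).
Proof.
move=> dgE dC a b c; rewrite !dgE (dC b a) (dC c a) (dC c b); lra.
Qed.

Section Gauss.
Variables (R : realType) (n m : nat).
Variables (G0 : 'rV[R]_n -> 'M[R]_n) (G : 'rV[R]_m -> 'M[R]_m).
Variables (U : 'rV[R]_n -> 'rV[R]_m) (y : 'rV[R]_n).
Hypothesis dU : \forall z \near y, differentiable U z.
Hypothesis ddU : forall b k,
  differentiable (pd b (fun z => U z 0 k) : 'rV[R]_n -> R^o) y.
Hypothesis symU : forall a b k,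
  pd a (pd b (fun z => U z 0 k)) y = pd b (pd a (fun z => U z 0 k)) y.
Hypothesis dG : forall k l, differentiable ((fun z => G z k l) : 'rV[R]_m -> R^o) (U y).
Hypothesis sG : \forall z \near U y, (G z)^T = G z.
Hypothesis uG : G (U y) \in unitmx.
Hypothesis G0E : \forall z \near y, pullback G U z = G0 z.
Hypothesis uG0 : G0 y \in unitmx.

Let dUy : differentiable U y := nbhs_singleton dU.
Let sGy : (G (U y))^T = G (U y) := nbhs_singleton sG.
Let J b := row b ('J U y).
Let D a b := row a (nabla_along G U (pdrow b U) y).

Definition second_form (a b : 'I_n) : 'rV[R]_m := \row_k nabla_d G0 G U k y a b.

Lemma pdrow_jacobian b z : differentiable U z -> pdrow b U z = row b ('J U z).
Proof. by move=> dz; apply/rowP => k; rewrite mxE [RHS]mxE jacobianE. Qed.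

Let pdrow_entry b k : (fun z => pdrow b U z 0 k) = pd b (fun z => U z 0 k).
Proof. by apply/funext => z; rewrite mxE. Qed.

Let dpdrow b k : differentiable ((fun z => pdrow b U z 0 k) : 'rV[R]_n -> R^o) y.
Proof.
exact: (eq_ind_r (fun F => differentiable (F : 'rV[R]_n -> R^o) y) (ddU b k) (pdrow_entry b k)).
Qed.

Let DE a b : D a b = pdrow a (pdrow b U) y + gamma G (U y) (J a) (J b).
Proof.
by rewrite /D nabla_along_row; congr (_ + gamma _ _ _ _); exact: pdrow_jacobian.
Qed.

Let pdrow2 a b k : pdrow a (pdrow b U) y 0 k = pd a (pd b (fun z => U z 0 k)) y.
Proof. by rewrite mxE pdrow_entry. Qed.

(** Absence of torsion: second partial derivatives of [U] commute and the Christoffel symbols are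
    symmetric in their lower indices. *)
Let D_sym a b : D a b = D b a.
Proof.
apply: etrans (DE a b) _; apply: etrans _ (esym (DE b a)).
apply: (congr2 +%R); last exact: gamma_sym.
apply/rowP => k; apply: etrans (pdrow2 a b k) _.
by apply: etrans _ (esym (pdrow2 b a k)); exact: symU.
Qed.

Let nG0E : \forall z \near y, forall b c,
  G0 z b c = ip (G (U z)) (pdrow b U z) (pdrow c U z).
Proof.
apply: filterS2 dU G0E => z dz <- b c.
by rewrite (pdrow_jacobian b dz) (pdrow_jacobian c dz) ip_row.
Qed.

Let pdG0 a b c : pd a (fun z => G0 z b c) y =
  ip (G (U y)) (D a b) (J c) + ip (G (U y)) (J b) (D a c).
Proof.
have E : \near y, G0 y b c = ip (G (U y)) (pdrow b U y) (pdrow c U y).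
  by apply: filterS nG0E => z.
by rewrite (pd_ext _ E) pd_ip// (pdrow_jacobian b dUy) (pdrow_jacobian c dUy).
Qed.

Let G0y b c : G0 y b c = ip (G (U y)) (J b) (J c).
Proof.
by rewrite (nbhs_singleton nG0E) (pdrow_jacobian b dUy) (pdrow_jacobian c dUy).
Qed.

Let sG0 : (G0 y)^T = G0 y.
Proof. by apply/matrixP => a b; rewrite mxE !G0y ipC. Qed.

(** The tangential part of the ambient derivative is torsion-free and compatible with the induced
    metric, so [koszul] gives it the first-kind symbols of that metric. *)
Let ip_D a b c : ip (G (U y)) (D a b) (J c) = christoffel1 G0 a b c y.
Proof.
apply: (@koszul _ _ (fun a b c => ip (G (U y)) (D a b) (J c))
  (fun a b c => pd a (fun z => G0 z b c) y)) => {}a {}b {}c.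
  by rewrite pdG0; congr (_ + _); exact: ipC.
exact: (congr1 (fun w => ip (G (U y)) w (J c)) (D_sym a b)).
Qed.

Lemma second_formE a b :
  second_form a b = D a b - \sum_c christoffel G0 a b c y *: J c.
Proof.
apply/rowP => k.
transitivity (pd a (pd b (fun z => U z 0 k)) y
    + gamma G (U y) (J a) (J b) 0 k - \sum_c christoffel G0 a b c y * J c 0 k).
  rewrite [LHS]mxE [LHS]mxE [X in X + _]mxE addrAC; congr (_ + _ - _).
    rewrite [RHS]mxE; apply: eq_bigr => c _; apply: eq_bigr => d _.
    by rewrite [J a 0 c]mxE [J b 0 d]mxE.
  by apply: eq_bigr => c _; rewrite [J c 0 k]mxE jacobianE.
have addE (v w : 'rV[R]_m) : (v + w) 0 k = v 0 k + w 0 k by rewrite mxE.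
have subE (v w : 'rV[R]_m) : (v - w) 0 k = v 0 k - w 0 k by rewrite addE [X in _ + X]mxE.
rewrite subE summxE (congr1 (fun v : 'rV[R]_m => v 0 k) (DE a b)) addE pdrow2.
by congr (_ - _); apply: eq_bigr => c _; rewrite [RHS]mxE.
Qed.

Lemma ipBl (v v' w : 'rV[R]_m) (K : 'M[R]_m) : ip K (v - v') w = ip K v w - ip K v' w.
Proof. by rewrite /ip !mulmxBl mxE [X in _ + X]mxE. Qed.

Lemma ip_suml (I : Type) (r : seq I) (c : I -> R) (v : I -> 'rV[R]_m) w (K : 'M[R]_m) :
  ip K (\sum_(i <- r) c i *: v i) w = \sum_(i <- r) c i * ip K (v i) w.
Proof.
rewrite /ip !mulmx_suml summxE; apply: eq_bigr => i _.
by rewrite -!scalemxAl mxE.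
Qed.

Lemma second_form_tangent a b c : ip (G (U y)) (second_form a b) (J c) = 0.
Proof.
rewrite second_formE ipBl ip_suml ip_D.
under eq_bigr do rewrite -G0y.
by rewrite christoffel_lower ?subrr.
Qed.

Variables (V : 'rV[R]_n -> 'rV[R]_m) (A : 'M[R]_n).
Hypothesis dV : forall k, differentiable ((fun z => V z 0 k) : 'rV[R]_n -> R^o) y.
Hypothesis nV : \forall z \near y, 'J U z *m G (U z) *m (V z)^T = 0.
Hypothesis AE : A *m 'J U y = - nabla_along G U V y.

(** Weingarten's relation: differentiating <[pdrow b U], V> = 0 moves the derivative onto the normal
    field, where [AE] expresses it through [A]. The tangential correction in [second_formE] is
    orthogonal to V. *)
Lemma second_form_normal a b : ip (G (U y)) (second_form a b) (V y) = (A *m G0 y) a b.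
Proof.
have nVy c : ip (G (U y)) (J c) (V y) = 0.
  by rewrite /ip -!row_mul (nbhs_singleton nV) row0 mxE.
rewrite second_formE ipBl ip_suml [X in _ - X]big1 ?subr0; last first.
  by move=> c _; rewrite nVy mulr0.
have E : \near y, ip (G (U y)) (pdrow b U y) (V y) = 0.
  apply: filterS2 dU nV => z dz nz.
  by rewrite (pdrow_jacobian b dz) /ip -!row_mul nz row0 mxE.
have := pd_ext a E; rewrite pd_const pd_ip// (pdrow_jacobian b dUy) => /eqP.
rewrite -/(D a b) addr_eq0 => /eqP ->.
have -> : row a (nabla_along G U V y) = - \sum_c A a c *: J c.
  rewrite -[nabla_along _ _ _ _]opprK -AE linearN /= row_mul; congr (- _).
  rewrite mulmx_sum_row; apply: eq_bigr => c _; by rewrite mxE.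
rewrite ipC// -[- \sum_c _]add0r ipBl {1}/ip !mul0mx mxE sub0r opprK ip_suml mxE.
by apply: eq_bigr => c _; rewrite G0y.
Qed.

End Gauss.

Section Hypersurface.
Variables (R : realType) (n : nat).

(* B G B^T = block_diag(1, J G J^T) for B = col_mx v J, so v and the rows of J
   form a basis. *)
Lemma normal_component (G : 'M[R]_(1 + n)) (J : 'M[R]_(n, 1 + n)) (v w : 'rV[R]_(1 + n)) :
  G^T = G -> v *m G *m v^T = 1%:M -> J *m G *m v^T = 0 ->
  J *m G *m J^T \in unitmx -> w *m G *m J^T = 0 ->
  w = (w *m G *m v^T) 0 0 *: v.
Proof.
move=> sG vv Jv uJ wJ; set t := (_ *m v^T) 0 0.
have vJ : v *m G *m J^T = 0.
  have -> : v *m G *m J^T = (J *m G *m v^T)^T by rewrite !trmx_mul trmxK sG mulmxA.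
  by rewrite Jv trmx0.
pose B : 'M[R]_(1 + n) := col_mx v J.
have : B *m G *m B^T \in unitmx.
  rewrite /B mul_col_mx tr_col_mx mul_col_row vv Jv vJ.
  by rewrite unitmxE det_ublock det1 mul1r -unitmxE.
rewrite -mulmxA unitmx_mul => /andP[_ uGB].
apply: (can_inj (mulmxK uGB)).
rewrite /B tr_col_mx !mul_mx_row -!scalemxAl !mulmxA wJ vJ scaler0 vv.
by rewrite [w *m G *m v^T]mx11_scalar -/t scalemx1.
Qed.

End Hypersurface.

(** * The height function of a hypersurface in a warped product *)

Section WarpedMetric.
Variables (R : realType) (n : nat) (f : R -> R) (mt : 'rV[R]_n -> 'M[R]_n).
Implicit Types (z : 'rV[R]_(1 + n)).

(** Has the shape of the metric of [warped] in a chart, with an arbitrary family [mt] for the fibre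
    metric, so that it can be studied on row vectors alone. *)
Definition wmetric z : 'M[R]_(1 + n) :=
  block_mx 1%:M 0 0 (f (lsubmx z 0 0) ^+ 2 *: mt (rsubmx z)).

Let o : 'I_(1 + n) := lshift n ord0.

Lemma wmetric_sym z : (mt (rsubmx z))^T = mt (rsubmx z) -> (wmetric z)^T = wmetric z.
Proof. by move=> sm; rewrite /wmetric tr_block_mx !trmx0 trmx1 linearZ /= sm. Qed.

Lemma wmetric_unitmx z : f (lsubmx z 0 0) != 0 -> mt (rsubmx z) \in unitmx ->
  wmetric z \in unitmx.
Proof.
move=> f0 um; rewrite /wmetric unitmxE det_ublock det1 mul1r -unitmxE.
by rewrite unitmxZ// unitfE expf_neq0.
Qed.

(** The t-component contributes its square to the squared length and the fibre part a nonnegative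
    amount. For the unit normal this is |Theta| <= 1. *)
Lemma wmetric_norm z (v : 'rV[R]_(1 + n)) : posdef (mt (rsubmx z)) ->
  v *m wmetric z *m v^T = 1%:M -> v 0 o ^+ 2 <= 1.
Proof.
move=> pm; have e1 : (lsubmx v *m (lsubmx v)^T) 0 0 = v 0 o ^+ 2.
  by rewrite mxE big_ord1 [_^T _ _]mxE expr2 !mxE.
have : v *m wmetric z *m v^T = lsubmx v *m (lsubmx v)^T +
    f (lsubmx z 0 0) ^+ 2 *: (rsubmx v *m mt (rsubmx z) *m (rsubmx v)^T).
  rewrite -[in LHS](hsubmxK v) /wmetric mul_row_block tr_row_mx mul_row_col.
  by rewrite mulmx1 !mulmx0 addr0 add0r -scalemxAr -scalemxAl.
move=> -> /matrixP/(_ 0 0); rewrite mxE e1 [X in _ + X]mxE [RHS]mxE /= => E.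
rewrite -[leRHS]E lerDl mulr_ge0 ?sqr_ge0//.
have [->|/pm/ltW//] := eqVneq (rsubmx v) 0.
by rewrite !mul0mx mxE.
Qed.

Let addE z (h : R) (a : 'I_(1 + n)) : (h *: delta_mx 0 o + z) 0 a = h * (a == o)%:R + z 0 a.
Proof. by rewrite !mxE eqxx. Qed.

Lemma wmetric_0r z a : wmetric z a o = (a == o)%:R.
Proof.
rewrite /wmetric; case: (split_ordP a) => i ->.
  by rewrite (ord1 i) block_mxEul mxE !eqxx.
by rewrite block_mxEdl mxE.
Qed.

Lemma wmetric_0l z a : wmetric z o a = (a == o)%:R.
Proof.
rewrite /wmetric; case: (split_ordP a) => i ->.
  by rewrite (ord1 i) block_mxEul mxE !eqxx.
by rewrite block_mxEur mxE.
Qed.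

(** Only the fibre block depends on t, through the factor f^2 with logarithmic derivative 2 f'/f;
    subtracting dt (x) dt from the metric leaves exactly that block. *)
Lemma pd0_wmetric z c d : derivable f (z 0 o) 1 -> f (z 0 o) != 0 ->
  pd o (fun w => wmetric w c d) z =
  2 * (f^`()%classic (z 0 o) / f (z 0 o)) * (wmetric z c d - (c == o)%:R * (d == o)%:R).
Proof.
move=> df f0.
have constE (F : 'rV[R]_(1 + n) -> R) k : (forall w, F w = k) -> pd o F z = 0.
  by move=> Fk; rewrite (_ : F = fun=> k) ?pd_const//; apply/funext.
have [-> |co] := eqVneq c o.
  rewrite wmetric_0l mul1r subrr mulr0; apply: (constE _ (d == o)%:R) => w.
  by rewrite wmetric_0l.
have [-> |dd] := eqVneq d o.
  rewrite wmetric_0r (negPf co) mul0r subr0 mulr0; apply: (constE _ 0) => w.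
  by rewrite wmetric_0r (negPf co).
rewrite mul0r subr0.
case: (split_ordP c) co => [i ->|i -> _]; first by rewrite (ord1 i) eqxx.
case: (split_ordP d) dd => [j ->|j -> _]; first by rewrite (ord1 j) eqxx.
have wE w : wmetric w (rshift 1 i) (rshift 1 j) = f (w 0 o) ^+ 2 * mt (rsubmx w) i j.
  by rewrite /wmetric block_mxEdr !mxE.
rewrite wE.
transitivity ('D_1 (fun t : R => f t * f t * mt (rsubmx z) i j : R^o) (z 0 o)).
  rewrite /pd /derive; congr (lim (_ @ 0^')); apply/funext => h /=.
  have E : rsubmx (h *: delta_mx 0 o + z) = rsubmx z.
    by apply/rowP => k; rewrite !mxE /= mulr0 add0r.
  by rewrite !wE E addE eqxx mulr1 [h%:A]mulr1 !expr2.
have D1 := derivableP df.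
have D2 := @is_deriveM R R^o f f (z 0 o) 1 _ _ D1 D1.
have D3 := @is_deriveM R R^o (f * f) (cst (mt (rsubmx z) i j)) (z 0 o) 1 _ _ D2
  (is_derive_cst _ _ _).
apply: etrans (@derive_val _ _ _ _ _ _ _ D3) _.
by rewrite scaler0 add0r -derive1E /GRing.scale /=; field.
Qed.

Lemma christoffel_wmetric z c d : derivable f (z 0 o) 1 -> f (z 0 o) != 0 ->
  (mt (rsubmx z))^T = mt (rsubmx z) -> mt (rsubmx z) \in unitmx ->
  christoffel wmetric c d o z =
  - (f^`()%classic (z 0 o) / f (z 0 o)) * (wmetric z c d - (c == o)%:R * (d == o)%:R).
Proof.
move=> df f0 sm um.
have f0' : f (lsubmx z 0 0) != 0 by rewrite mxE.
have := christoffel_lower c d o (wmetric_sym sm) (wmetric_unitmx f0' um).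
rewrite (bigD1 o)//= wmetric_0l eqxx mulr1 big1 ?addr0; last first.
  by move=> k /negPf ko; rewrite wmetric_0r ko mulr0.
move=> ->; rewrite /christoffel1 pd0_wmetric//.
have c0 a b : pd a (fun w => wmetric w b o) z = 0.
  rewrite (_ : (fun w => _) = fun=> (b == o)%:R) ?pd_const//.
  by apply/funext => w; rewrite wmetric_0r.
by rewrite !c0; field.
Qed.

End WarpedMetric.

Section HeightEquation.
Variables (R : realType) (n : nat) (f : R -> R) (mt : 'rV[R]_n -> 'M[R]_n).
Variables (G0 : 'rV[R]_n -> 'M[R]_n) (U : 'rV[R]_n -> 'rV[R]_(1 + n)).
Variable y : 'rV[R]_n.

Let o : 'I_(1 + n) := lshift n ord0.
Let G := wmetric f mt.
Let h (z : 'rV[R]_n) := U z 0 o.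
Let L := f^`()%classic (U y 0 o) / f (U y 0 o).

Hypothesis df : derivable f (U y 0 o) 1.
Hypothesis f0 : f (U y 0 o) != 0.
Hypothesis smt : \forall z \near U y, (mt (rsubmx z))^T = mt (rsubmx z).
Hypothesis umt : mt (rsubmx (U y)) \in unitmx.
Hypothesis pmt : posdef (mt (rsubmx (U y))).
Hypothesis dG : forall k l, differentiable ((fun z => G z k l) : 'rV[R]_(1 + n) -> R^o) (U y).
Hypothesis dU : \forall z \near y, differentiable U z.
Hypothesis ddU : forall b k,
  differentiable (pd b (fun z => U z 0 k) : 'rV[R]_n -> R^o) y.
Hypothesis symU : forall a b k,
  pd a (pd b (fun z => U z 0 k)) y = pd b (pd a (fun z => U z 0 k)) y.
Hypothesis G0E : \forall z \near y, pullback G U z = G0 z.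
Hypothesis uG0 : G0 y \in unitmx.
Variables (V : 'rV[R]_n -> 'rV[R]_(1 + n)) (A : 'M[R]_n).
Hypothesis dV : forall k, differentiable ((fun z => V z 0 k) : 'rV[R]_n -> R^o) y.
Hypothesis nV : \forall z \near y, 'J U z *m G (U z) *m (V z)^T = 0.
Hypothesis vV : V y *m G (U y) *m (V y)^T = 1%:M.
Hypothesis AE : A *m 'J U y = - nabla_along G U V y.

Let sG : \forall z \near U y, (G z)^T = G z.
Proof. by apply: filterS smt => z; exact: wmetric_sym. Qed.

Let uG : G (U y) \in unitmx.
Proof. by apply: wmetric_unitmx => //; move: f0; rewrite mxE. Qed.

(** Gauss formula: the second fundamental form is orthogonal to the tangent vectors, the normal
    space is the line of [V y], and [second_form_normal] gives the coefficient. *)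
Let secondE a b : second_form G0 G U y a b = (A *m G0 y) a b *: V y.
Proof.
have E := second_form_normal dU ddU dG sG uG G0E dV nV AE a b.
rewrite -E; apply: (@normal_component _ _ (G (U y)) ('J U y)) => //.
- exact: nbhs_singleton sG.
- exact: nbhs_singleton nV.
- by have := nbhs_singleton G0E; rewrite /pullback => ->.
- apply/rowP => c; rewrite [RHS]mxE.
  have <- := second_form_tangent dU ddU symU dG sG uG G0E uG0 a b c.
  rewrite /ip !mxE; apply: eq_bigr => k _.
  by rewrite ![_^T _ _]mxE [row c _ 0 k]mxE.
Qed.

Let JE a : 'J U y a o = pd a h y.
Proof. exact: jacobianE (nbhs_singleton dU). Qed.

(** The [o]-component of the Gauss formula. As h is the [o]-component of U, the left-hand side is
    Hess h plus a Christoffel term, which equals -L (g - dh (x) dh). *)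
Lemma hessian_height a b : hessian G0 h y a b =
  L * (G0 y a b - pd a h y * pd b h y) + V y 0 o * (A *m G0 y) a b.
Proof.
have := congr1 (fun v : 'rV[R]_(1 + n) => v 0 o) (secondE a b).
rewrite /= [LHS]mxE [LHS]mxE [RHS]mxE => E.
have S : \sum_c \sum_d christoffel G c d o (U y) * 'J U y a c * 'J U y b d =
   - L * (G0 y a b - pd a h y * pd b h y).
  under eq_bigr do under eq_bigr do rewrite christoffel_wmetric//
    ?(nbhs_singleton smt)// -/L -/G.
  rewrite -(nbhs_singleton G0E) /pullback -!JE.
  transitivity (- L * (\sum_c \sum_d ('J U y a c * G (U y) c d * 'J U y b d
      - 'J U y a c * (c == o)%:R * ('J U y b d * (d == o)%:R)))).
    rewrite mulr_sumr; apply: eq_bigr => c _; rewrite mulr_sumr.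
    by apply: eq_bigr => d _; rewrite -/o; ring.
  congr (_ * _); under eq_bigr do rewrite sumrB; rewrite sumrB; congr (_ - _).
    rewrite mxE exchange_big; apply: eq_bigr => d _ /=; rewrite [_^T _ _]mxE.
    by rewrite [in RHS]mxE mulr_suml.
  rewrite -big_distrlr /=; congr (_ * _).
    rewrite (bigD1 o)//= ?eqxx mulr1 big1 ?addr0// => c /negPf ->.
    by rewrite mulr0.
  rewrite (bigD1 o)//= ?eqxx mulr1 big1 ?addr0// => c /negPf ->.
  by rewrite mulr0.
rewrite S in E; rewrite (canRL (addrK _) E).
by move: (G0 y a b) ((A *m G0 y) a b) (V y 0 o) (pd a h y) (pd b h y) L => *; ring.
Qed.

(* Chosen so that [elliptic (invmx G0) drift h] is Delta h + L |dh|^2: one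
   factor of the quadratic term is frozen into the coefficient. *)
Definition drift : 'rV[R]_n := \row_c
  (- (\sum_a \sum_b invmx (G0 y) a b * christoffel G0 a b c y)
   + L * \sum_b invmx (G0 y) b c * pd b h y).

(** The trace of Hess h is computed twice, by [hessian_height] ([T3]) and by its coordinate
    definition ([T4]); the |dh|^2 term of the former cancels the second summand of [drift]. *)
Lemma elliptic_height :
  elliptic (invmx (G0 y)) drift h y = n%:R * L + V y 0 o * \tr A.
Proof.
have sG0 : (G0 y)^T = G0 y.
  rewrite -(nbhs_singleton G0E) /pullback !trmx_mul trmxK mulmxA.
  by rewrite (nbhs_singleton sG).
have contr (B : 'M[R]_n) : \sum_a \sum_b invmx (G0 y) a b * B a b = \tr (B *m invmx (G0 y)).
  rewrite /mxtrace exchange_big; transitivity (\sum_b \sum_a B b a * invmx (G0 y) a b).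
    rewrite exchange_big; apply: eq_bigr => a _; apply: eq_bigr => b _ /=.
    have -> : invmx (G0 y) a b = invmx (G0 y) b a by rewrite -{1}sG0 -trmx_inv mxE.
    by rewrite mulrC.
  by apply: eq_bigr => b _; rewrite mxE.
have T1 : \sum_a \sum_b invmx (G0 y) a b * G0 y a b = n%:R.
  by rewrite contr mulmxV// mxtrace1.
have T2 : \sum_a \sum_b invmx (G0 y) a b * (A *m G0 y) a b = \tr A.
  by rewrite contr -mulmxA mulmxV// mulmx1.
have T3 : \sum_a \sum_b invmx (G0 y) a b * hessian G0 h y a b =
    L * n%:R - L * (\sum_a \sum_b invmx (G0 y) a b * (pd a h y * pd b h y))
    + V y 0 o * \tr A.
  rewrite -T1 -T2 !mulr_sumr -sumrB -big_split; apply: eq_bigr => a _ /=.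
  rewrite !mulr_sumr -sumrB -big_split; apply: eq_bigr => b _ /=.
  rewrite hessian_height.
  by move: (G0 y a b) ((A *m G0 y) a b) (V y 0 o) (pd a h y) (pd b h y) L => *; ring.
have T4 : \sum_a \sum_b invmx (G0 y) a b * hessian G0 h y a b =
    \sum_a \sum_b invmx (G0 y) a b * pd a (pd b h) y -
    \sum_c (\sum_a \sum_b invmx (G0 y) a b * christoffel G0 a b c y) * pd c h y.
  transitivity (\sum_a \sum_b invmx (G0 y) a b * pd a (pd b h) y -
    \sum_a \sum_b \sum_c invmx (G0 y) a b * christoffel G0 a b c y * pd c h y).
    rewrite -sumrB; apply: eq_bigr => a _; rewrite -sumrB; apply: eq_bigr => b _.
    rewrite mxE mulrBr mulr_sumr; congr (_ - _); apply: eq_bigr => c _.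
    by rewrite mulrA.
  congr (_ - _); under eq_bigr do rewrite exchange_big.
  rewrite exchange_big; apply: eq_bigr => c _ /=; rewrite mulr_suml.
  by apply: eq_bigr => a _; rewrite mulr_suml.
rewrite /elliptic.
have -> : \sum_i drift 0 i * pd i h y =
   - (\sum_c (\sum_a \sum_b invmx (G0 y) a b * christoffel G0 a b c y) * pd c h y)
   + L * (\sum_a \sum_b invmx (G0 y) a b * (pd a h y * pd b h y)).
  rewrite -sumrN exchange_big mulr_sumr -big_split; apply: eq_bigr => c _ /=.
  rewrite mxE mulrDl mulNr -mulrA; congr (_ + L * _).
  by rewrite mulr_suml; apply: eq_bigr => a _; rewrite mulrA.
by rewrite addrA -T4 T3; ring.
Qed.

(** A unit normal has t-component t >= -1, whence L + t H >= L - H >= 0. *)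
Lemma elliptic_height_ge0 (H : R) : n%:R * H = \tr A -> 0 <= H <= L ->
  0 <= elliptic (invmx (G0 y)) drift h y.
Proof.
move=> HA /andP[H0 HL]; rewrite elliptic_height -HA.
have := wmetric_norm pmt vV; rewrite -/o; move: (V y 0 o) => t t1.
have t2 : -1 <= t by nra.
move: L HL => l HL.
have -> : n%:R * l + t * (n%:R * H) = n%:R * (l + t * H) by ring.
by rewrite mulr_ge0//; nra.
Qed.

End HeightEquation.

(** * Regularity of the coefficients *)

Lemma continuous_det (R : realType) (T : topologicalType) n (A : T -> 'M[R]_n) y :
  (forall i j, {for y, continuous (fun z => A z i j)}) ->
  {for y, continuous (fun z => \det (A z))}.
Proof.
move=> cA; apply: continuous_bigsum => s.
by apply: continuous_mul; [exact: continuous_const|exact: continuous_bigprod].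
Qed.

(** Cramer's formula. [invmx] returns a singular matrix unchanged, so the formula is used only near
    [y], where the determinant stays nonzero. *)
Lemma continuous_invmx (R : realType) (T : topologicalType) n (A : T -> 'M[R]_n) y i j :
  (forall i j, {for y, continuous (fun z => A z i j)}) -> A y \in unitmx ->
  {for y, continuous (fun z => invmx (A z) i j)}.
Proof.
move=> cA; rewrite unitmxE unitfE => d0; have cd := continuous_det cA.
have cofc : {for y, continuous (fun z => cofactor (A z) j i)}.
  apply: continuous_mul; first exact: continuous_const.
  apply: continuous_det => k l.
  rewrite (_ : (fun z => _) = fun z => A z (lift j k) (lift i l)); first exact: cA.
  by apply/funext => z; rewrite !mxE.
have cq : {for y, continuous (fun z => (\det (A z))^-1 * cofactor (A z) j i)}.
  by apply: continuous_mul => //; exact: cvgV.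
apply: near_eq_continuous cq.
have dn0 : \forall z \near y, \det (A z) != 0 by exact: (cvgr_neq0 _ cd d0).
by apply: filterS dn0 => z dz; rewrite /invmx unitmxE unitfE dz !mxE.
Qed.

Section SmoothEntries.
Variables (R : realType) (n p q : nat).
Variables (U : set 'rV[R]_n) (F : 'rV[R]_n -> 'M[R]_(p, q)).
Hypothesis oU : open U.
Hypothesis sF : smooth_on U F.

(** Level k + 1 of [smooth_on] makes the derivatives of order k differentiable; level 3 thus yields
    continuous second derivatives. *)
Let dF y : U y -> differentiable F y.
Proof. exact: (sF 1).1. Qed.

Let dDF v y : U y -> differentiable ('D_v F) y.
Proof. exact: ((sF 2).2 v).1. Qed.

Let dDDF v w y : U y -> differentiable ('D_w ('D_v F)) y.
Proof. exact: (((sF 3).2 v).2 w).1. Qed.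

Let nU y : U y -> \forall z \near y, U z.
Proof. by move=> Uy; exact: open_nbhs_nbhs. Qed.

Lemma smooth_differentiable i j y : U y ->
  differentiable ((fun z => F z i j) : 'rV[R]_n -> R^o) y.
Proof. by move=> Uy; apply: differentiable_entry; exact: dF. Qed.

Let pdE b i j y : U y -> \forall z \near y,
  ('D_(delta_mx 0 b) F z) i j = pd b (fun z => F z i j) z.
Proof. by move=> /nU; apply: filterS => z /dF dz; rewrite /pd derive_entry. Qed.

Lemma smooth_differentiable_pd b i j y : U y ->
  differentiable (pd b (fun z => F z i j) : 'rV[R]_n -> R^o) y.
Proof.
move=> Uy; apply: near_eq_differentiable (pdE b i j Uy) _.
exact/differentiable_entry/dDF.
Qed.

Lemma smooth_continuous_pd2 a b i j y : U y ->
  {for y, continuous (pd a (pd b (fun z => F z i j)))}.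
Proof.
move=> Uy; apply: (@near_eq_continuous _ _
  (fun z => ('D_(delta_mx 0 a) ('D_(delta_mx 0 b) F) z) i j)); last first.
  exact: differentiable_continuous (differentiable_entry i j (dDDF _ _ Uy)).
apply: filterS (nU Uy) => z Uz.
by rewrite -(pd_ext a (pdE b i j Uz)) /pd derive_entry//; exact: dDF.
Qed.

Lemma smooth_pd_sym a b i j y : U y ->
  pd a (pd b (fun z => F z i j)) y = pd b (pd a (fun z => F z i j)) y.
Proof.
move=> Uy; apply: derive_sym.
- by apply: filterS (nU Uy) => z Uz; exact: smooth_differentiable.
- by apply: filterS (nU Uy) => z Uz; exact: smooth_differentiable_pd.
- by apply: filterS (nU Uy) => z Uz; exact: smooth_differentiable_pd.
- exact: smooth_continuous_pd2.
- exact: smooth_continuous_pd2.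
Qed.

End SmoothEntries.

Lemma smooth_continuous_christoffel (R : realType) n (U : set 'rV[R]_n)
    (G : 'rV[R]_n -> 'M[R]_n) a b c y :
  open U -> smooth_on U G -> U y -> G y \in unitmx ->
  {for y, continuous (christoffel G a b c)}.
Proof.
move=> oU sG Uy uG.
have cpd k i j : {for y, continuous (pd k (fun z => G z i j))}.
  exact: differentiable_continuous (smooth_differentiable_pd oU sG k i j Uy).
apply: continuous_mul; first exact: continuous_const.
apply: continuous_bigsum => d; apply: continuous_mul.
  apply: continuous_invmx => // i j.
  exact: differentiable_continuous (smooth_differentiable sG i j Uy).
by apply: continuous_sub => //; exact: continuous_add.
Qed.

Section WarpingFunction.
Variables (R : realType) (I : set R) (f : R -> R).
Hypothesis sf : @smooth_on R R^o R^o I f.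

Lemma smooth_derivable t : I t -> derivable f t 1.
Proof. by move=> It; apply: diff_derivable; exact: (sf 1).1. Qed.

Lemma smooth_continuous_derive1 t : I t -> {for t, continuous f^`()%classic}.
Proof.
move=> It; rewrite (_ : f^`()%classic = 'D_1 (f : R^o -> R^o)).
  exact: differentiable_continuous (((sf 2).2 1).1 t It).
by apply/funext => x; exact: derive1E.
Qed.

Lemma derive1_ln_comp t : I t -> 0 < f t ->
  derive1 (fun t => ln (f t) : R^o) t = f^`()%classic t / f t.
Proof.
move=> It f0; have dl := is_derive1_ln f0.
rewrite (derive1_comp (g := @ln R)); last 2 first.
- exact: smooth_derivable.
- by case: dl.
by rewrite derive1E; case: dl => _ ->; rewrite mulrC.
Qed.

End WarpingFunction.

Lemma differentiable_wmetric (R : realType) n (f : R -> R) (mt : 'rV[R]_n -> 'M[R]_n)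
    (z : 'rV[R]_(1 + n)) k l :
  differentiable (f : R^o -> R^o) (z 0 (lshift n ord0)) ->
  (forall i j, differentiable ((fun w => mt w i j) : 'rV[R]_n -> R^o) (rsubmx z)) ->
  differentiable ((fun w => wmetric f mt w k l) : 'rV[R]_(1 + n) -> R^o) z.
Proof.
move=> df dm.
case: (split_ordP k) => i ->.
  rewrite (ord1 i) (_ : (fun w => _) = fun=> (l == lshift n ord0)%:R).
    exact: differentiable_const.
  by apply/funext => w; rewrite wmetric_0l.
case: (split_ordP l) => j ->.
  rewrite (ord1 j) (_ : (fun w => _) = fun=> (rshift 1 i == lshift n ord0)%:R).
    exact: differentiable_const.
  by apply/funext => w; rewrite wmetric_0r.
have dfz : differentiable ((fun w : 'rV[R]_(1 + n) => f (w 0 (lshift n ord0))) : _ -> R^o) z.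
  apply: (@differentiable_comp _ _ _ _ (fun w : 'rV[R]_(1 + n) => w 0 (lshift n ord0) : R^o)) => //.
  exact: differentiable_coordinate.
have dmz : differentiable ((fun w : 'rV[R]_(1 + n) => mt (rsubmx w) i j) : _ -> R^o) z.
  apply: (@differentiable_comp _ _ _ _ rsubmx (fun w => mt w i j : R^o)) => //.
  exact: differentiable_rsubmx.
rewrite (_ : (fun w => _) = fun w : 'rV[R]_(1 + n) => f (w 0 (lshift n ord0)) * f (w 0 (lshift n ord0))
   * mt (rsubmx w) i j).
  by apply: differentiable_scalarM => //; exact: differentiable_scalarM.
by apply/funext => w; rewrite /wmetric block_mxEdr !mxE expr2.
Qed.

(** * The height function on the manifold *)

Section HeightSubsolution.
Variables (R : realType) (n : nat) (I : set R) (f : R -> R) (M S : riemData R n).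
Variables (phi : S -> warped I f M).
Variables (nu : chart_ix (warped I f M) -> S -> 'rV[R]_(1 + n)).
Variables (A : chart_ix S -> S -> 'M[R]_n) (H : S -> R).
Hypothesis sf : @smooth_on R R^o R^o I f.
Hypothesis f_gt0 : forall t, I t -> 0 < f t.
Hypothesis rM : riemannian M.
Hypothesis rS : riemannian S.
Hypothesis immphi : isometric_immersion phi.
Hypothesis unu : unit_normal phi nu.
Hypothesis shA : shape_operator phi nu A.
Hypothesis trA : forall i x, chart_dom S i x -> n%:R * H x = \tr (A i x).
Hypothesis HL : forall x,
  0 <= H x <= derive1 (fun t => ln (f t) : R^o) (height phi x).

Let o : 'I_(1 + n) := lshift n ord0.
Let atS : smooth_atlas S.
Proof. by case: rS => [[]]. Qed.

Let cphi : continuous phi.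
Proof. by case: immphi => -[]. Qed.

Lemma continuous_height : continuous (height phi).
Proof.
move=> x; apply: (@continuous_comp _ _ _ (fst \o phi) (@set_val _ I)).
  apply: (@continuous_comp _ _ _ phi fst); first exact: cphi.
  exact: cvg_fst.
exact: initial_continuous.
Qed.

Section Chart.
Variables (i : chart_ix S) (j : chart_ix (warped I f M)).

Let W := loc_dom phi i j.
Let U := locmap phi i j.
Let G0 := metric S i.
Let V := loc i (nu j).

Let open_pre : open (phi @^-1` chart_dom (warped I f M) j).
Proof.
case: rM => -[_ _ [_ atM _]] _; have [oj _ _ _] := atM j.
apply: open_comp => [x _|]; first exact: cphi.
by apply: (@open_comp _ _ snd) => // q _; exact: cvg_snd.
Qed.

Let oW : open W.
Proof. by case: atS => _ /(_ i)[_ _ _ im] _; exact: im. Qed.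

Let UE x : chart_dom S i x -> U (chart S i x) = chart (warped I f M) j (phi x).
Proof. exact: locE. Qed.

Lemma loc_height x : chart_dom S i x -> U (chart S i x) 0 o = height phi x.
Proof.
by move=> ix; rewrite UE// /chart /= row_mxEl !mxE eqxx.
Qed.

Let rsubU x : chart_dom S i x -> rsubmx (U (chart S i x)) = chart M j (phi x).2.
Proof. by move=> ix; rewrite UE// /chart /= row_mxKr. Qed.

Let oM : open (chart_im (X := M) j setT).
Proof. by case: rM => -[_ _ [_ /(_ j)[_ _ _ im] _]] _; apply: im; exact: openT. Qed.

Let oS : open (chart_im i setT).
Proof. by case: atS => _ /(_ i)[_ _ _ im] _; apply: im; exact: openT. Qed.

Let WS y : W y -> chart_im i setT y.
Proof. by move=> [x [ix _] <-]; exists x. Qed.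

Let WM y : W y -> chart_im (X := M) j setT (rsubmx (U y)).
Proof. by move=> [x [ix jx] <-]; rewrite rsubU//; exists (phi x).2. Qed.

Let WI y : W y -> I (U y 0 o).
Proof. by move=> [x [ix jx] <-]; rewrite loc_height//; exact: set_valP. Qed.

Let pM y : W y -> posdef (metric M j (rsubmx (U y))).
Proof. by move=> /WM ?; case: rM => _ [_ _ pos _] v; exact: pos. Qed.

Let pS y : W y -> posdef (G0 y).
Proof. by move=> /WS ?; case: rS => _ [_ _ pos _] v; exact: pos. Qed.

Let symS y : W y -> (G0 y)^T = G0 y.
Proof. by move=> /WS ?; case: rS => _ [_ sym _ _]; exact: sym. Qed.

Let smM y : W y -> \forall z \near U y, (metric M j (rsubmx z))^T = metric M j (rsubmx z).
Proof.
move=> /WM Wy; case: rM => _ [_ sym _ _].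
have nw : \forall w \near rsubmx (U y), chart_im (X := M) j setT w.
  exact: open_nbhs_nbhs.
have nz : \forall z \near U y, chart_im (X := M) j setT (rsubmx z).
  exact: (@continuous_rsubmx R 1 1 n (U y) _ nw).
by apply: filterS nz => z; exact: sym.
Qed.

Let sU : smooth_on W U.
Proof. by case: immphi => -[_ sphi] _ _; exact: sphi. Qed.

Let sV : smooth_on W V.
Proof. by case: unu => -[_ snu] _; exact: snu. Qed.

Let sG0 : smooth_on (chart_im i setT) G0.
Proof. by case: rS => _ [sm _ _ _]; exact: sm. Qed.

Let nW y : W y -> \forall z \near y, W z.
Proof. by move=> Wy; exact: open_nbhs_nbhs. Qed.

Let b y := drift f G0 U y.

Let F y := U y 0 o.

Let VE x : chart_dom S i x -> V (chart S i x) = nu j x.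
Proof. exact: locE. Qed.

Let normalV y : W y -> V y *m wmetric f (metric M j) (U y) *m (V y)^T = 1%:M /\
  'J U y *m wmetric f (metric M j) (U y) *m (V y)^T = 0.
Proof.
move=> [x [ix jx] <-]; rewrite (VE ix) (UE ix).
by case: unu => _ /(_ i j x ix jx).
Qed.

Lemma height_subsolution y : W y -> 0 <= elliptic (invmx (G0 y)) (b y) F y.
Proof.
move=> Wy; have Iy := WI Wy; have [x [ix jx] xy] := Wy.
have f0 : f (U y 0 o) != 0 by rewrite gt_eqF// f_gt0.
apply: (@elliptic_height_ge0 R n f (metric M j) G0 U y
  (smooth_derivable sf Iy) f0 (smM Wy) (posdef_unitmx (pM Wy)) (pM Wy) _ _ _ _ _
  (posdef_unitmx (pS Wy)) V (A i x) _ _ _ _ (H x)).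
- move=> k l; apply: differentiable_wmetric; first exact: (sf 1).1.
  move=> c d; case: rM => _ [sm _ _ _].
  by have := smooth_differentiable (sm j) c d (WM Wy); apply.
- by apply: filterS (nW Wy) => z; exact: (sU 1).1.
- by move=> c k; exact: (smooth_differentiable_pd oW sU).
- by move=> c d k; exact: (smooth_pd_sym oW sU).
- case: immphi => _ _ iso.
  by apply: filterS (nW Wy) => z; exact: iso.
- by move=> k; exact: (smooth_differentiable sV).
- by apply: filterS (nW Wy) => z /normalV[].
- by case: (normalV Wy).
- by rewrite -xy; exact: shA.
- exact: trA.
- have := HL x; rewrite (derive1_ln_comp sf) -?xy ?loc_height//.
    exact: set_valP.
  exact/f_gt0/set_valP.
Qed.

Lemma height_strong_maximum m x : (forall x', height phi x' <= m) ->
  chart_dom S i x -> chart_dom (warped I f M) j (phi x) -> height phi x = m ->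
  \forall x' \near x, height phi x' = m.
Proof.
move=> hm ix jx hx.
have Wx : W (chart S i x) by exists x.
have cG0 y : W y -> forall k l, {for y, continuous (fun z => G0 z k l)}.
  move=> /WS Wy k l.
  exact: differentiable_continuous (smooth_differentiable sG0 k l Wy).
have cinv y k l : W y -> {for y, continuous (fun z => invmx (G0 z) k l)}.
  by move=> Wy; apply: continuous_invmx; [exact: cG0|exact/posdef_unitmx/pS].
have cF y : W y -> {for y, continuous F}.
  by move=> Wy; exact: differentiable_continuous (smooth_differentiable sU 0 o Wy).
have : \forall y \near chart S i x, F y = m.
  apply: (@strong_maximum R n W F m (fun y => invmx (G0 y)) b oW).
  - by move=> y Wy; have := smooth_differentiable sU 0 o Wy; apply.
  - by move=> c y Wy; have := smooth_differentiable_pd oW sU c 0 o Wy; apply.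
  - by move=> k l y; exact: cinv.
  (* Unfolding [drift] shows what must be continuous: inverse metric, Christoffel symbols, f'/f at
     the height and its first derivatives. Neither shape operator nor normal occurs. *)
  - move=> c y Wy; rewrite (_ : (fun z => b z 0 c) = fun z =>
      (- (\sum_k \sum_l invmx (G0 z) k l * christoffel G0 k l c z)
       + f^`()%classic (F z) / f (F z) * \sum_l invmx (G0 z) l c * pd l F z)); last first.
      by apply/funext => z; rewrite mxE.
    apply: continuous_add.
      apply: continuousN; apply: continuous_bigsum => k; apply: continuous_bigsum => l.
      apply: continuous_mul; first exact: cinv.
      exact: (@smooth_continuous_christoffel R n _ G0 k l c y oS sG0 (WS Wy)
        (posdef_unitmx (pS Wy))).
    apply: continuous_mul.
      apply: continuous_mul.
        apply: (@continuous_comp _ _ _ F f^`()%classic); first exact: cF.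
        by have := smooth_continuous_derive1 sf (WI Wy); apply.
      apply: continuous_inv; last by rewrite gt_eqF// f_gt0//; exact: WI.
      apply: (@continuous_comp _ _ _ F f); first exact: cF.
      exact: differentiable_continuous ((sf 1).1 _ (WI Wy)).
    apply: continuous_bigsum => l; apply: continuous_mul; first exact: cinv.
    exact: differentiable_continuous (smooth_differentiable_pd oW sU l 0 o Wy).
  - by move=> y Wy; rewrite trmx_inv symS.
  - by move=> y Wy; apply: posdef_invmx; [exact: symS|exact: pS].
  - exact: height_subsolution.
  - by move=> y [x' [ix' jx'] <-]; rewrite /F loc_height.
  - exact: Wx.
  - by rewrite /F loc_height.
case: atS => _ /(_ i)[oi _ ci _] _.
move=> /(ci x ix) Fm.
have ni : \forall x' \near x, chart_dom S i x' by exact: open_nbhs_nbhs.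
by apply: filterS2 ni Fm => x' ix'; rewrite /F /= loc_height.
Qed.

End Chart.

Lemma height_constant : compact [set: S] -> connected [set: S] ->
  einstein_harmonic (height phi).
Proof.
(* [connected] admits the empty space; the claim is then vacuous and 0 serves as the constant. *)
move=> kS cS; have [S0|/set0P/negP/negPn/eqP S0] := pselect ([set: S] !=set0); last first.
  by exists 0 => x; have : [set: S] x by []; rewrite S0.
have [|x0 _ hx0] := compact_EVT_max S0 kS (_ : {within _, continuous (height phi)}).
  exact: continuous_subspaceT continuous_height.
pose m := height phi x0; exists m => x.
have hm x' : height phi x' <= m by apply: hx0; rewrite inE.
suff E : [set x | height phi x = m] = [set: S].
  by have : [set: S] x by []; rewrite -E.
apply: cS; first by exists x0.
- exists [set x | height phi x = m]; last by rewrite setTI.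
  rewrite openE => x1 hx1.
  case: (atS) => /(_ x1)[i ix] _ _.
  case: rM => -[_ _ [/(_ (phi x1).2)[j jx] _ _]] _.
  exact: (@height_strong_maximum i j m x1 hm ix jx hx1).
- exists [set x | height phi x = m]; last by rewrite setTI.
  apply: (@preimage_closed _ _ (height phi) [set t | t = m]); last exact: closed_eq.
  by move=> y _; exact: continuous_height.
Qed.

End HeightSubsolution.

(** * The structure equations for a constant potential *)

Section ConstantPotential.
Variables (R : realType) (n p : nat) (X : riemData R n) (N : riemData R p).
Variables (alpha : R) (h : X -> R) (u : X -> N) (mu lambda : X -> R).

(** [loc] is 0 outside the chart image, so [F] is known to be constant only on that image; since the
    image is open, all derivatives at its points vanish, and with them [dif], [hessian] and
    [grad]. *)
Lemma einstein_type_constant : smooth_atlas X ->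
  einstein_type_equations alpha h u mu lambda -> einstein_harmonic h ->
  harmonic_einstein_equations alpha u lambda.
Proof.
move=> atX E [c hc] i j x ix jx y G G' U.
have [] := E i j x ix jx; rewrite -/y -/G -/G' -/U /=.
set F := loc i (h : X -> R^o).
have oX : open (chart_im i setT).
  by case: atX => _ /(_ i)[_ _ _ im] _; apply: im; exact: openT.
have Fc z : chart_im i setT z -> F z = c.
  by move=> [x' [ix' _] <-]; rewrite /F locE.
have pdF b z : chart_im i setT z -> pd b F z = 0.
  move=> Xz; rewrite -(pd_const b c z); apply: pd_ext.
  have : \forall w \near z, chart_im i setT w by exact: open_nbhs_nbhs.
  by apply: filterS => w /Fc.
have Xy : chart_im i setT y by exists x.
have dF0 : dif F y = 0 by apply/rowP => b; rewrite !mxE pdF.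
have hF0 : hessian G F y = 0.
  apply/matrixP => a b; rewrite !mxE big1 => [|k _]; last by rewrite pdF// mulr0.
  rewrite subr0 -(pd_const a 0 y); apply: pd_ext.
  have : \forall w \near y, chart_im i setT w by exact: open_nbhs_nbhs.
  by apply: filterS => w; exact: pdF.
by rewrite hF0 /grad dF0 mulmx0 scaler0 subr0 addr0 !mul0mx.
Qed.

End ConstantPotential.

Theorem theorem4p1 (R : realType) (n p : nat)
    (I : set R) (f : R -> R) (M : riemData R n)
    (Sigma : riemData R n) (N : riemData R p)
    (alpha : R) (u : Sigma -> N) (mu lambda : Sigma -> R)
    (phi : Sigma -> warped I f M)
    (nu : chart_ix (warped I f M) -> Sigma -> 'rV[R]_(1 + n))
    (H : Sigma -> R) :
  open I -> is_interval I ->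
  @smooth_on R R^o R^o I f -> (forall t, I t -> 0 < f t) ->
  riemannian M -> connected [set: M] -> oriented_atlas M ->
  gradient_einstein_type alpha (height phi) u mu lambda ->
  compact [set: Sigma] -> oriented_atlas Sigma ->
  isometric_immersion phi ->
  unit_normal phi nu ->
  mean_curvature phi nu H ->
  (forall x, 0 <= H x <= derive1 (fun t => ln (f t) : R^o) (height phi x)) ->
  einstein_harmonic (height phi) /\
  harmonic_einstein_equations alpha u lambda.
Proof.
move=> _ _ sf f0 rM _ _ [[rS cS _] _ _ _ E] kS _ imm un [A sA trA] HL.
have hc := height_constant sf f0 rM rS imm un sA trA HL kS cS.
split=> //; apply: einstein_type_constant E hc.
by case: rS => -[].
Qed.
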